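(* Let $\mathfrak{D}=(x_k,u_k)_{k=1}^N$ with $x_k\in \mathrm{H}^1([0,\tau_k];\mathbb{R}^n)$ and $u_k\in \mathrm{L}^2([0,\tau_k];\mathbb{R}^m)$ for $k=1,\dots,N$, and let $\Theta\in\mathbb{S}^{2n+m}_+$ be partitioned as $\Theta=\begin{bmatrix}\Theta_{11}&\Theta_{12}\\ \Theta_{12}^\top&\Theta_{22}\end{bmatrix}$ with $\Theta_{11}\in\mathbb{S}^n$, $\Theta_{22}\in\mathbb{S}^{n+m}$. Suppose that $\Theta_{11}-\Theta_{12}\Theta_{22}^+\Theta_{12}^\top\succ 0$. Then for all $A\in\mathbb{R}^{n\times n}$ and $B\in\mathbb{R}^{n\times m}$ the following statements are equivalent: (i) $(A,B)\in\Sigma_{\mathfrak{D},\Theta}$. (ii) $\begin{bmatrix} I_n\\ A^\top\\ B^\top\end{bmatrix}^\top(\Theta-ZZ^* )\begin{bmatrix} I_n\\ A^\top\\ B^\top\end{bmatrix}\succeq 0$, where $ZZ^*\in\mathbb{S}_+^{2n+m}$ is the data-associated Gramian.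
   Context: Notation: $n,m,N$ are positive integers and $\tau_1,\dots,\tau_N>0$, $\tau=(\tau_k)_{k=1}^N$. $\mathbb{S}^n$, $\mathbb{S}^n_+$ are the real symmetric and real symmetric nonnegative definite $n\times n$ matrices; $\succ,\succeq,\prec,\preceq$ denote the definiteness order; $\Theta^+$ is the Moore--Penrose inverse. $\mathrm{H}^1([a,b];\mathbb{R}^n)$ is the space of absolutely continuous $\phi:[a,b]\to\mathbb{R}^n$ with $\phi'\in \mathrm{L}^2([a,b];\mathbb{R}^n)$. $\mathrm{H}^1_0[a,b]$ is the space of real-valued $\phi\in\mathrm{H}^1([a,b];\mathbb{R})$ with $\phi(a)=\phi(b)=0$, a Hilbert space with inner product $\langle\phi,\psi\rangle=\int_a^b\phi'(t)\psi'(t)\,dt$. $\mathcal{H}_\tau$ is the orthogonal direct sum of the Hilbert spaces $\mathrm{H}^1_0[0,\tau_k]$, $k=1,\dots,N$, i.e. tuples $\phi=(\phi_k)_{k=1}^N$ with the sum of the componentwise inner products. Data-associated Gramian: for $\phi\in\mathcal{H}_\tau$ put $X_{\mathrm d}\phi=-\sum_{k=1}^N\int_0^{\tau_k}\phi_k'(t)x_k(t)\,dt$, $X\phi=\sum_{k=1}^N\int_0^{\tau_k}\phi_k(t)x_k(t)\,dt$, $U\phi=\sum_{k=1}^N\int_0^{\tau_k}\phi_k(t)u_k(t)\,dt$. The bounded linear operator $Z:\mathcal{H}_\tau\to\mathbb{R}^{2n+m}$ is $Z\phi=\begin{bmatrix}X_{\mathrm d}\phi\\-X\phi\\-U\phi\end{bmatrix}$,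 and $ZZ^*$ ($Z^*$ the Hilbert space adjoint) is identified with a $(2n+m)\times(2n+m)$ matrix. Noise class: for $p_k,q_k\in \mathrm{L}^2([0,\tau_k];\mathbb{R}^n)$, $r_k\in \mathrm{L}^2([0,\tau_k];\mathbb{R}^m)$ $(k=1,\dots,N)$, define $W:\mathcal{H}_\tau\to\mathbb{R}^{2n+m}$ by $W\phi=\sum_{k=1}^N\int_0^{\tau_k}\phi_k(t)\begin{bmatrix}p_k(t)\\-q_k(t)\\-r_k(t)\end{bmatrix}dt$. $\Delta_{\tau,\Theta}$ is the set of all such tuples $(p_k,q_k,r_k)_{k=1}^N$ with $WW^*\preceq\Theta$. Data-consistent systems: $\Sigma_{\mathfrak{D},\Theta}$ is the set of all $(A,B)\in\mathbb{R}^{n\times n}\times\mathbb{R}^{n\times m}$ for which there exists $(p_k,q_k,r_k)_{k=1}^N\in\Delta_{\tau,\Theta}$ such that $x_k'-p_k=A(x_k-q_k)+B(u_k-r_k)$ a.e. on $[0,\tau_k]$ for all $k=1,\dots,N$. *)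

(* Defs.v *)
From HB Require Import structures.
From mathcomp Require Import all_boot all_order all_algebra.
From mathcomp Require Import all_classical all_reals all_analysis.

Set Implicit Arguments.
Unset Strict Implicit.
Unset Printing Implicit Defensive.

Import Order.TTheory GRing.Theory Num.Theory.
Import numFieldNormedType.Exports.

Local Open Scope classical_set_scope.
Local Open Scope ring_scope.

Section Matrices.
Context {R : realType}.

Definition psd {d} (M : 'M[R]_d) : Prop :=
  M^T = M /\ forall v : 'cV[R]_d, 0 <= (v^T *m M *m v) 0 0.

Definition posdef {d} (M : 'M[R]_d) : Prop :=
  M^T = M /\ forall v : 'cV[R]_d, v != 0 -> 0 < (v^T *m M *m v) 0 0.

Definition loewner_le {d} (M P : 'M[R]_d) : Prop := psd (P - M).

Definition penrose {d e} (M : 'M[R]_(d, e)) (P : 'M[R]_(e, d)) : Prop :=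
  [/\ M *m P *m M = M, P *m M *m P = P,
      (M *m P)^T = M *m P & (P *m M)^T = P *m M].

(* The four Penrose equations have exactly one solution, so the default value
   0 is never used. *)
Definition mp_inverse {d e} (M : 'M[R]_(d, e)) : 'M[R]_(e, d) :=
  xget 0 (penrose M).

End Matrices.

(* A function on [a, b] is represented by a function on the whole of R.  Its
   values outside [a, b] influence the notions below only through the values of
   derive1 at the endpoints, which form a null set.  Spaces of R^d-valued
   functions, their derivatives and integrals are componentwise. *)
Section FunctionSpaces.
Context {R : realType}.
Local Notation mu := (@lebesgue_measure R).

Definition L2 (a b : R) (f : R -> R) : Prop :=
  (f \_ `[a, b]) \in Lfun mu 2%:E.

Definition abs_continuous (a b : R) (f : R -> R) : Prop :=
  forall e : R, 0 < e -> exists2 delta : R, 0 < delta &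
    forall (l : nat) (s t : 'I_l -> R),
      (forall i, [/\ a <= s i, s i <= t i & t i <= b]) ->
      trivIset [set: 'I_l] (fun i => `]s i, t i[%classic) ->
      \sum_i (t i - s i) < delta ->
      \sum_i `|f (t i) - f (s i)| < e.

(* derive1 f takes a constant default value where f is not differentiable; for
   an absolutely continuous f this happens only on a Lebesgue-null set.  As
   derive1 f is then automatically Borel measurable on [a, b], the measurability
   contained in L2 is no additional requirement. *)
Definition H1 (a b : R) (f : R -> R) : Prop :=
  abs_continuous a b f /\ L2 a b (derive1 f).

Definition H10 (a b : R) (f : R -> R) : Prop :=
  [/\ H1 a b f, f a = 0 & f b = 0].

Definition L2v {d} (a b : R) (f : R -> 'cV[R]_d) : Prop :=
  forall i, L2 a b (fun t => f t i 0).

Definition H1v {d} (a b : R) (f : R -> 'cV[R]_d) : Prop :=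
  forall i, H1 a b (fun t => f t i 0).

Definition derivev {d} (f : R -> 'cV[R]_d) (t : R) : 'cV[R]_d :=
  \col_i derive1 (fun s => f s i 0) t.

Definition integralv {d} (a b : R) (f : R -> 'cV[R]_d) : 'cV[R]_d :=
  \col_i \int[mu]_(t in `[a, b]) (f t i 0).

End FunctionSpaces.

Section HilbertSpace.
Context {R : realType} {N : nat} (tau : 'I_N -> R).
Local Notation mu := (@lebesgue_measure R).

Definition Htau : set ('I_N -> R -> R) :=
  [set phi | forall k, H10 0 (tau k) (phi k)].

Definition Htau_inner (phi psi : 'I_N -> R -> R) : R :=
  \sum_k \int[mu]_(t in `[0, tau k]) (derive1 (phi k) t * derive1 (psi k) t).

(* The Hilbert space adjoint T^* : R^d -> Htau.  For a bounded linear T the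
   representer psi of phi |-> <T phi, v> exists by the Riesz theorem and is
   unique on the intervals [0, tau k]. *)
Definition adjoint {d} (T : ('I_N -> R -> R) -> 'cV[R]_d) (v : 'cV[R]_d) :
    'I_N -> R -> R :=
  xget (fun _ _ => 0) [set psi | Htau psi /\
    forall phi, Htau phi -> ((T phi)^T *m v) 0 0 = Htau_inner phi psi].

(* The matrix of T T^* in the standard basis. *)
Definition gramian {d} (T : ('I_N -> R -> R) -> 'cV[R]_d) : 'M[R]_d :=
  \matrix_(i, j) T (adjoint T (delta_mx j 0)) i 0.

End HilbertSpace.

Section Data.
Context {R : realType} {n m N : nat} (tau : 'I_N -> R).
Local Notation mu := (@lebesgue_measure R).

Section Operators.
Context (x : 'I_N -> R -> 'cV[R]_n) (u : 'I_N -> R -> 'cV[R]_m).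

Definition Xd_op (phi : 'I_N -> R -> R) : 'cV[R]_n :=
  - \sum_k integralv 0 (tau k) (fun t => derive1 (phi k) t *: x k t).

Definition X_op (phi : 'I_N -> R -> R) : 'cV[R]_n :=
  \sum_k integralv 0 (tau k) (fun t => phi k t *: x k t).

Definition U_op (phi : 'I_N -> R -> R) : 'cV[R]_m :=
  \sum_k integralv 0 (tau k) (fun t => phi k t *: u k t).

Definition Z_op (phi : 'I_N -> R -> R) : 'cV[R]_(n + (n + m)) :=
  col_mx (Xd_op phi) (col_mx (- X_op phi) (- U_op phi)).

End Operators.

Definition W_op (p q : 'I_N -> R -> 'cV[R]_n) (r : 'I_N -> R -> 'cV[R]_m)
    (phi : 'I_N -> R -> R) : 'cV[R]_(n + (n + m)) :=
  \sum_k integralv 0 (tau k)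
    (fun t => phi k t *: col_mx (p k t) (col_mx (- q k t) (- r k t))).

Definition Delta (Theta : 'M[R]_(n + (n + m))) :
    set (('I_N -> R -> 'cV[R]_n) * ('I_N -> R -> 'cV[R]_n)
         * ('I_N -> R -> 'cV[R]_m)) :=
  [set w | let: (p, q, r) := w in
    [/\ forall k, L2v 0 (tau k) (p k),
        forall k, L2v 0 (tau k) (q k),
        forall k, L2v 0 (tau k) (r k) &
        loewner_le (gramian tau (W_op p q r)) Theta]].

Definition Sigma (x : 'I_N -> R -> 'cV[R]_n) (u : 'I_N -> R -> 'cV[R]_m)
    (Theta : 'M[R]_(n + (n + m))) : set ('M[R]_n * 'M[R]_(n, m)) :=
  [set AB | exists p q r, Delta Theta (p, q, r) /\
    forall k, {ae mu, forall t, t \in `[0, tau k] ->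
      derivev (x k) t - p k t =
        AB.1 *m (x k t - q k t) + AB.2 *m (u k t - r k t)}].

End Data.

(* Main.v *)
(* For phi in Htau, integration by parts turns Z into the operator W of the triple
   (x', x, u).  Writing C for the block column [I; A^T; B^T], the composition
   C^T Z is therefore phi |-> int phi e with the residual e = x' - A x - B u, while
   C^T W is phi |-> int phi (p - A q - B r).
   If (A, B) is consistent with the data, the two coincide, hence
   C^T Z Z^* C = C^T W W^* C <= C^T Theta C.
   Conversely, the Schur complement condition makes M = C^T Theta C positive
   definite, and the noise (p; -q; -r) = Theta C M^-1 e satisfies the system
   because C^T Theta C M^-1 = 1; moreover
   W W^* = Theta C M^-1 (C^T Z Z^* C) M^-1 C^T Theta
         <= Theta C M^-1 C^T Theta <= Theta.
   Integration by parts requires the fundamental theorem of calculus for absolutely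
   continuous f.  It is obtained from a monotonicity criterion: a sum of a
   nondecreasing and an absolutely continuous function whose upper right derivate is
   nonnegative almost everywhere is nondecreasing.  Applied to the variation of f it
   shows that the derivate D of f is integrable; applied to f - int D and int D - f
   it gives f = f(a) + int D, and Lebesgue differentiation does the rest. *)
Require Import Defs.
From HB Require Import structures.
From mathcomp Require Import all_boot all_order all_algebra.
From mathcomp Require Import all_classical all_reals all_analysis.
From mathcomp Require Import measurable_realfun ring lra.

Import Order.TTheory GRing.Theory Num.Theory.
Import numFieldNormedType.Exports.

Local Open Scope classical_set_scope.
Local Open Scope ring_scope.

(** * Absolutely continuous functions *)

Section AbsoluteContinuity.
Context {R : realType}.
Local Notation mu := (@lebesgue_measure R).
Implicit Types (f g F G V : R -> R) (a b x y : R).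

Definition dquot f x (n : nat) : R := (f (x + n.+1%:R^-1) - f x) * n.+1%:R.

(** Disjointness is asked of the open intervals only, so that adjacent intervals may be appended.
    The set [O] confines the closed intervals: it is an open cover of the exceptional set in the
    real induction, and the whole line when the total variation is formed. *)
Definition var_sum F (O : set R) a x (S : R) : Prop :=
  exists (l : nat) (s t : 'I_l -> R),
    [/\ forall i, [/\ a <= s i, s i <= t i & t i <= x],
        forall i, `[s i, t i] `<=` O,
        trivIset [set: 'I_l] (fun i => `]s i, t i[%classic) &
        S = \sum_i `|F (t i) - F (s i)|].

Lemma var_sum0 F O a x : var_sum F O a x 0.
Proof.
exists 0%N, (fun=> 0), (fun=> 0); split => //; [by case|by case| |].
  by case.
by rewrite big_ord0.
Qed.

Lemma var_sumS F O a x y S : x <= y -> var_sum F O a x S -> var_sum F O a y S.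
Proof.
move=> xy [l [s [t [h1 h2 h3 h4]]]]; exists l, s, t; split => // i.
by have [? ? ?] := h1 i; split => //; exact: le_trans xy.
Qed.

(** The interval [x, y] lies to the right of all earlier ones, whose right endpoints are at most x;
    it receives the index [ord0]. *)
Lemma var_sum_extend F O a x y S : a <= x -> x <= y -> `[x, y] `<=` O ->
  var_sum F O a x S -> var_sum F O a y (S + `|F y - F x|).
Proof.
move=> ax xy xyO [l [s [t [h1 h2 h3 h4]]]].
pose s' i := oapp s x (unlift (@ord0 l) i).
pose t' i := oapp t y (unlift (@ord0 l) i).
exists l.+1, s', t'; split.
- move=> i; rewrite /s' /t'; case: unliftP => [j _|_] //=.
  by have [? ? ?] := h1 j; split => //; exact: le_trans xy.
- by move=> i; rewrite /s' /t'; case: unliftP => [j _|_] //=; exact: h2.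
- move=> i j _ _; rewrite /s' /t'.
  case: unliftP => [i' ->|->]; case: unliftP => [j' ->|->] //= [z []] /=.
  + rewrite -!/(_ `]_, _[) => zi zj; congr lift; apply: h3 => //.
    by exists z.
  + have [_ _ tx] := h1 i'; rewrite !in_itv/= => /andP[_ zt] /andP[xz _].
    by have := lt_trans xz zt; rewrite ltNge tx.
  + have [_ _ tx] := h1 j'; rewrite !in_itv/= => /andP[xz _] /andP[_ zt].
    by have := lt_trans xz zt; rewrite ltNge tx.
- rewrite h4 big_ord_recl /s' /t' unlift_none /= addrC; congr (_ + _).
  by apply: eq_bigr => i _; rewrite liftK.
Qed.

(** The total length of the intervals is the measure of their disjoint union, which lies in [O]
    intersected with [c, x]. *)
Lemma var_sum_lt F a b (e : R) : abs_continuous a b F -> 0 < e ->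
  exists2 delta : R, 0 < delta & forall O c x S, measurable O ->
    a <= c -> x <= b -> (mu (O `&` `[c, x]) < delta%:E)%E ->
    var_sum F O c x S -> S < e.
Proof.
move=> acF e0; have [delta d0 H] := acF e e0; exists delta => // O c x S mO ac xb muO.
move=> [l [s [t [h1 h2 h3 ->]]]]; apply: (H l s t) => //.
- by move=> i; have [? ? ?] := h1 i; split => //;
    [exact: le_trans ac _|exact: le_trans xb].
rewrite -lte_fin; apply: le_lt_trans muO.
rewrite -sumEFin.
rewrite [X in (X <= _)%E](_ : _ = \sum_(i < l) mu `]s i, t i[%classic)%E; last first.
  apply: eq_bigr => i _; rewrite lebesgue_measure_itv /= lte_fin -EFinB.
  have [_ + _] := h1 i; rewrite le_eqVlt => /orP[/eqP ->|->//].
  by rewrite ltxx subrr.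
rewrite -(@measure_bigsetU_ord _ _ _ mu _ xpredT (fun i => `]s i, t i[%classic)) //.
apply: le_measure; rewrite ?inE.
- by apply: bigsetU_measurable => i _; exact: measurable_itv.
- by apply: measurableI => //; exact: measurable_itv.
rewrite -bigcup_seq => z [i _] /= zi.
have [csi siti tix] := h1 i; move: zi; rewrite in_itv/= => /andP[sz zt]; split.
  by apply: (h2 i); rewrite /= in_itv /= !ltW.
by rewrite /= in_itv/= (le_trans csi (ltW sz)) (le_trans (ltW zt) tix).
Qed.

Lemma abs_continuous_uniform F a b (e : R) : abs_continuous a b F -> 0 < e ->
  exists2 delta : R, 0 < delta & forall x y, a <= x -> x <= y -> y <= b ->
    y - x < delta -> `|F y - F x| < e.
Proof.
move=> acF e0; have [d d0 H] := acF e e0; exists d => // x y ax xy yb xyd.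
have := H 1%N (fun=> x) (fun=> y); rewrite !big_ord1; apply => //.
by move=> i j _ _ _; rewrite [i]ord1 [j]ord1.
Qed.

(* Real induction along [a, b]: cover N by an open set U of small measure; up to x,
   the decrease of V + F is at most e (x - a) plus a variation sum of F over
   intervals contained in U, which absolute continuity keeps small. *)
Lemma nondecreasing_of_dquot V F a b (N : set R) : a <= b ->
  mu.-negligible N -> abs_continuous a b F ->
  (forall x y, a <= x -> x <= y -> y <= b -> V x <= V y) ->
  (forall x, a < x < b -> ~ N x -> forall e : R, 0 < e -> forall M,
    exists2 n, (M <= n)%N & - e <= dquot (V \+ F) x n) ->
  V a + F a <= V b + F b.
Proof.
move=> ab negN acF ndV dG.
(* The slack has three sources: a rate e along [a, b], a variation sum below e, and a final margin
   eta = e. *)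
suff H (e : R) : 0 < e -> V a + F a <= V b + F b + e * (b - a + 2).
  apply/ler_addgt0Pr => e e0.
  have k0 : 0 < b - a + 2 by rewrite ltr_wpDl ?subr_ge0.
  have := H (e / (b - a + 2)) (divr_gt0 e0 k0).
  by rewrite divfK ?gt_eqF.
move=> e0; have [delta d0 Hd] := var_sum_lt F a b e acF e0.
(* The point a joins the exceptional set, since the hypothesis on quotients concerns interior points
   only. *)
have negNa : mu.-negligible (N `|` [set a]).
  apply: negligibleU => //; apply/negligibleP => //; exact: lebesgue_measure_set1.
have d20 : 0 < delta / 2 by rewrite divr_gt0.
have [U [oU NU muU]] := @outer_measure_open_le R (N `|` [set a]) (delta / 2) d20.
have {}muU : (mu U < delta%:E)%E.
  apply: (le_lt_trans muU).
  rewrite ((negligible_outer_measure _).1 negNa) add0e lte_fin.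
  by rewrite ltr_pdivrMr // ltr_pMr // ltr1n.
pose P x := forall eta, 0 < eta -> exists2 S, var_sum F U a x S &
  V a + F a - S - e * (x - a) - eta <= V x + F x.
pose E := [set x | [/\ a <= x, x <= b & P x]].
have Ea : E a.
  split => // eta eta0; exists 0; first exact: var_sum0.
  by rewrite subrr mulr0 !subr0 gerBl ltW.
have supE : has_sup E.
  by split; [exists a | exists b => x [_ ? _]].
set c := sup E.
have ac : a <= c by apply: ub_le_sup => //; case: supE.
have cb : c <= b by apply: ge_sup; [exists a | move=> x []].
have Pc : P c.
  move=> eta eta0; have eta20 : 0 < eta / 2 by rewrite divr_gt0.
  have [d dp Hdc] := abs_continuous_uniform F a b (eta / 2) acF eta20.
  have [x [ax xb Px] cdx] := sup_adherent dp supE.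
  have xc : x <= c by apply: ub_le_sup => //; case: supE.
  have [S vS HS] := Px _ eta20.
  exists S; first exact: var_sumS vS.
  have h1 := ndV x c ax xc cb.
  have h2 : `|F c - F x| < eta / 2 by apply: Hdc => //; rewrite -/c in cdx; lra.
  have h3 : e * (x - a) <= e * (c - a) by rewrite ler_pM2l // lerB.
  by move: h2; rewrite ltr_norml => /andP[h2 _]; lra.
have mU : measurable U by exact: measurable_realfun.open_measurable.
have cEb : c = b.
  apply/eqP; rewrite eq_le cb leNgt; apply/negP => {}cb.
  suff [y cy Ey] : exists2 y, c < y & E y.
    have : y <= c by apply: ub_le_sup => //; case: supE.
    by rewrite leNgt cy.
  (* Inside [U] the whole increment of [F] from c to y is charged to the variation sum. *)
  have [cU|cU] := pselect (U c).
    have /nbhs_ballP[r /= r0 cr] : nbhs c U by exact: open_nbhs_nbhs.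
    exists (Num.min b (c + r / 2)).
      by rewrite lt_min cb ltrDl divr_gt0.
    set y := Num.min _ _.
    have cy : c <= y by rewrite le_min (ltW cb) lerDl divr_ge0 ?ltW.
    have yr : y < c + r.
      by rewrite gt_min ltrD2l ltr_pdivrMr // ltr_pMr // ltr1n orbT.
    have yb : y <= b by rewrite ge_min lexx.
    split => //; first exact: le_trans ac _.
    move=> eta eta0; have [S vS HS] := Pc eta eta0.
    exists (S + `|F y - F c|).
      apply: var_sum_extend => // z /=; rewrite in_itv/= => /andP[cz zy].
      apply: cr; rewrite /ball/= ltr_distlC; lra.
    have h1 := ndV c y ac cy yb.
    have h3 : e * (c - a) <= e * (y - a) by rewrite ler_pM2l // lerB.
    have := ler_norm (- (F y - F c)); rewrite normrN; lra.
  (* Outside [U] the point c is interior and not exceptional, so a right quotient of at least - e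
     carries the estimate to c + 1 / (n + 1) at cost e / (n + 1). *)
  have ca : a < c.
    rewrite lt_neqAle ac andbT; apply/eqP => aE; apply: cU; apply: NU; right.
    by rewrite aE.
  have Nc : ~ N c by move=> Nc; apply: cU; apply: NU; left.
  have acb : a < c < b by rewrite ca.
  have [M _ HM] : \forall n \near \oo, (n.+1%:R^-1 : R) < b - c.
    by apply: near_infty_natSinv_lt (PosNum _); rewrite subr_gt0.
  have [n Mn] := dG c acb Nc e e0 M.
  have := HM n Mn => nb.
  have n0 : 0 < n.+1%:R^-1 :> R by rewrite invr_gt0.
  rewrite /dquot -ler_pdivrMr ?invr_gt0 // => Hn.
  exists (c + n.+1%:R^-1); first by rewrite ltrDl.
  move: (n.+1%:R^-1) nb n0 Hn => q nb n0 Hn.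
  split => //; [lra | lra |].
  move=> eta eta0; have [S vS HS] := Pc eta eta0; exists S.
    by apply: var_sumS vS; rewrite lerDl ltW.
  move: Hn; rewrite /= mulNr; lra.
have [S vS HS] := Pc e e0.
have : S < e.
  apply: (Hd U a c) => //; apply: le_lt_trans muU; apply: le_measure; rewrite ?inE //.
  by apply: measurableI => //; exact: measurable_itv.
by move: HS; rewrite cEb; nra.
Qed.

Lemma abs_continuousN F a b : abs_continuous a b F -> abs_continuous a b (\- F).
Proof.
move=> acF e e0; have [d d0 H] := acF e e0; exists d => // l s t h1 h2 h3.
apply: le_lt_trans (H l s t h1 h2 h3); rewrite le_eqVlt; apply/orP; left.
by apply/eqP; apply: eq_bigr => i _; rewrite /= -opprD normrN.
Qed.

(** The integral of |k| over a set tends to zero with the measure of the set; this is applied to the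
    union of the given intervals, with k extended by zero outside [a, b]. *)
Lemma abs_continuous_integral (k : R -> R) a b :
  mu.-integrable `[a, b] (EFin \o k) ->
  abs_continuous a b (fun x => \int[mu]_(t in `[a, x]) k t).
Proof.
move=> intk; pose g := k \_ `[a, b].
have intg : mu.-integrable setT (EFin \o g).
  by move: intk; rewrite integrable_mkcond //= restrict_EFin.
move=> e e0; have [d [d0 H]] := integral_normr_continuous intg e0.
exists d => // l s t h1 h2 h3.
pose D := \big[setU/set0]_(i < l) (`]s i, t i[%classic : set R).
have mi i : measurable (`]s i, t i[%classic : set R) by exact: measurable_itv.
have mD : measurable D by apply: bigsetU_measurable.
have muD : (mu D < d%:E)%E.
  have -> : mu D = (\sum_(i < l) mu `]s i, t i[%classic)%E.
    by rewrite -(@measure_bigsetU_ord _ _ _ mu _ xpredT (fun i => `]s i, t i[%classic)).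
  rewrite (eq_bigr (fun i => (t i - s i)%:E)) ?sumEFin ?lte_fin // => i _.
  rewrite lebesgue_measure_itv /= lte_fin -EFinB.
  have [_ + _] := h1 i; rewrite le_eqVlt => /orP[/eqP ->|->//].
  by rewrite ltxx subrr.
have intgn (A : set R) : measurable A -> mu.-integrable A (EFin \o (fun x => `|g x|)).
  move=> mA; apply: (@integrableS _ _ _ mu setT) => //.
  exact: (integrable_norm intg).
have Fi i : `|\int[mu]_(x in `[a, t i]) k x - \int[mu]_(x in `[a, s i]) k x| <=
    \int[mu]_(x in `]s i, t i[) `|g x|.
  have [asi siti tib] := h1 i.
  have sub1 : `]s i, t i[ `<=` `[a, b].
    by apply: subset_itv; rewrite bnd_simp.
  have sub2 : `]s i, t i] `<=` `[a, b].
    by apply: subset_itv; rewrite bnd_simp.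
  have sub3 : `[a, t i] `<=` `[a, b].
    by apply: subset_itv; rewrite bnd_simp.
  rewrite Rintegral_itvB ?bnd_simp //; last first.
    by apply: integrableS intk => //; exact: measurable_itv.
  rewrite -Rintegral_itv_bndo_bndc //; last first.
    by apply: integrableS intk => //; exact: measurable_itv.
  apply: le_trans.
    apply: le_normr_Rintegral => //.
    by apply: integrableS intk => //; exact: measurable_itv.
  rewrite le_eqVlt; apply/orP; left; apply/eqP.
  by apply: eq_Rintegral => x /set_mem/sub1 xab; rewrite /g patchE mem_set.
apply: le_lt_trans (ler_sum _ (fun i _ => Fi i)) _.
apply: le_lt_trans (H D mD muD).
rewrite -lee_fin -sumEFin le_eqVlt; apply/orP; left; apply/eqP.
rewrite [RHS]fineK; last exact: integrable_fin_num (intgn _ mD).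
rewrite ge0_integral_bigsetU //=.
- by apply: eq_bigr => i _; rewrite fineK //; exact: integrable_fin_num (intgn _ (mi i)).
- exact: index_enum_uniq.
- by move=> i j _ _; exact: h2.
- exact: measurable_int (intgn _ mD).
Qed.

(** * Upper right derivates and the fundamental theorem of calculus *)

Lemma dquot_cvg f x : derivable f x 1 -> dquot f x n @[n --> \oo] --> derive1 f x.
Proof.
move=> df; have : (fun h => h^-1 *: (f (h + x) - f x)) @ 0^' --> derive1 f x.
  rewrite derive1E.
  have := df; rewrite /derivable /derive => /cvg_ex[l fl].
  have -> : (fun h : R => h^-1 *: (f (h + x) - f x)) =
      (fun h => h^-1 *: (f (h *: 1 + x) - f x)).
    by apply/funext => h; rewrite /GRing.scale /= mulr1.
  by move: (fl) => /cvg_lim ->.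
move=> /cvgr_dnbhsP/(_ (fun n => n.+1%:R^-1)) H.
have -> : (fun n => dquot f x n) =
    (fun n => (n.+1%:R^-1)^-1 *: (f (n.+1%:R^-1 + x) - f x)).
  by apply/funext => n; rewrite /dquot invrK [_ + x]addrC; exact: mulrC.
by apply: H; split; [move=> n; rewrite invr_neq0 | exact: cvg_harmonic].
Qed.

Lemma limn_esup_ge_frequently (u : nat -> R) l e M :
  (l%:E <= limn_esup (EFin \o u))%E -> 0 < e -> exists2 n, (M <= n)%N & l - e <= u n.
Proof.
move=> lu e0; apply: contrapT => H.
have {}H n : (M <= n)%N -> u n < l - e.
  by move=> Mn; rewrite ltNge; apply/negP => ?; apply: H; exists n.
suff : (limn_esup (EFin \o u) <= (l - e)%:E)%E.
  by move=> /(le_trans lu); rewrite lee_fin; lra.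
apply: (@le_trans _ _ (ereal_sup ((EFin \o u) @` [set n | (M <= n)%N]))).
  by apply: ereal_inf_lbound; exists [set n | (M <= n)%N] => //; exists M.
apply: ge_ereal_sup => _ [n /= Mn <-].
by rewrite lee_fin ltW // H.
Qed.

Lemma limn_esup_le_frequently (u : nat -> R) l e M :
  (limn_esup (EFin \o u) <= l%:E)%E -> 0 < e -> exists2 n, (M <= n)%N & u n <= l + e.
Proof.
move=> lu e0; apply: contrapT => H.
have {}H n : (M <= n)%N -> l + e < u n.
  by move=> Mn; rewrite ltNge; apply/negP => ?; apply: H; exists n.
suff : ((l + e)%:E <= limn_esup (EFin \o u))%E.
  by move=> /le_trans/(_ lu); rewrite lee_fin; lra.
apply: le_ereal_inf_tmp => _ [A [M' _ AM'] <-].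
apply: (@le_trans _ _ (u (maxn M M'))%:E).
  by rewrite lee_fin ltW // H // leq_maxl.
apply: ereal_sup_ubound; exists (maxn M M') => //.
by apply: AM'; exact: leq_maxr.
Qed.

(* Restricting the right derivate to the increments 1 / (n + 1) makes it measurable
   at once, and nondecreasing_of_dquot needs no other increments. *)
Definition upper_dini f x : \bar R := limn_esup (fun n => (dquot f x n)%:E).

Lemma measurable_upper_dini f : continuous f -> measurable_fun setT (upper_dini f).
Proof.
move=> cf; apply: measurable_fun_limn_esup => n; apply/measurable_EFinP.
apply: measurable_funM => //.
apply: measurable_funB; last exact: continuous_measurable_fun.
apply: (measurableT_comp (continuous_measurable_fun cf)).
by apply: measurable_funD.
Qed.

(** A nonnegative upper limit is nearly reached infinitely often; a negative one keeps the quotients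
    near or below it, so that their absolute value is large. *)
Lemma abs_upper_dini_ge f x (k e : R) M : (k%:E <= `|upper_dini f x|)%E -> 0 < e ->
  exists2 n, (M <= n)%N & k - e <= `|dquot f x n|.
Proof.
move=> kh e0; have [h0|h0] := leP 0%E (upper_dini f x).
  move: kh; rewrite gee0_abs // => kh.
  have [n Mn Hn] := limn_esup_ge_frequently _ _ e M kh e0.
  by exists n => //; apply: (le_trans Hn); exact: ler_norm.
move: kh; rewrite lte0_abs // leeNr => kh.
have [n Mn Hn] := limn_esup_le_frequently _ _ e M kh e0.
exists n => //; rewrite -normrN; apply: le_trans (ler_norm _); lra.
Qed.

Lemma dquotD f g x n : dquot (f \+ g) x n = dquot f x n + dquot g x n.
Proof. rewrite /dquot /=; ring. Qed.

Lemma dquotN f x n : dquot (\- f) x n = - dquot f x n.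
Proof. rewrite /dquot /=; ring. Qed.

(** Almost every point is a Lebesgue point, and there the primitive is differentiable. Extending k
    by zero leaves the primitive unchanged at all y <= b, hence near x. *)
Lemma ae_is_derive_integral (k : R -> R) a b : mu.-integrable `[a, b] (EFin \o k) ->
  {ae mu, forall x, a < x < b ->
    is_derive x 1 (fun y => \int[mu]_(t in `[a, y]) k t) (k x)}.
Proof.
move=> intk.
have loc := integrable_locally (measurable_itv _) intk.
have := lebesgue_differentiation loc.
apply: filterS; first exact: (ae_filter_ringOfSetsType mu).
move=> x xL /andP[ax xb].
pose g := k \_ `[a, b].
have intg : mu.-integrable `[a, b] (EFin \o g).
  apply: eq_integrable intk => //.
  by move=> y yab; rewrite /= /g patchE yab.
have [|dF F'] := FTC1_lebesgue_pt xb intg _ xL; first by rewrite ?lte_fin.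
have gx : g x = k x by rewrite /g patchE mem_set //= in_itv/= !ltW.
have : is_derive x 1 (fun y => \int[mu]_(t in `[a, y]) g t) (k x).
  by rewrite -gx; split; [exact: dF|rewrite -derive1E; exact: F'].
apply: near_eq_is_derive.
near=> y.
have yb : y <= b by apply: ltW; near: y; exact: lt_nbhsl.
apply: eq_Rintegral => t /set_mem /=; rewrite in_itv /= => /andP[at_ ty].
by rewrite /g patchE mem_set //= in_itv /= at_ (le_trans ty).
Unshelve. all: by end_near. Qed.

Lemma ae_dquot_integral (k : R -> R) a b : mu.-integrable `[a, b] (EFin \o k) ->
  {ae mu, forall x, a < x < b ->
    dquot (fun y => \int[mu]_(t in `[a, y]) k t) x n @[n --> \oo] --> k x}.
Proof.
move=> /ae_is_derive_integral; apply: filterS; first exact: (ae_filter_ringOfSetsType mu).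
move=> x H axb; have [dF F'] := H axb.
by rewrite -F' -derive1E; exact: dquot_cvg.
Qed.

(* With V the variation of f and k = min(|upper_dini f|, K), the function
   V - int k is nondecreasing; then K tends to infinity. *)
Lemma upper_dini_integral_le f c d : c <= d -> continuous f ->
  (forall S, var_sum f setT c d S -> S <= 1) ->
  (\int[mu]_(x in `[c, d]) `|upper_dini f x| <= 1)%E.
Proof.
move=> cd cf vf.
have mh := measurable_upper_dini f cf.
(* Truncation at K yields a bounded, hence integrable function before anything is known about the
   size of the derivate. *)
pose k (K : nat) x : R := fine (mine `|upper_dini f x|%E K%:R%:E).
have kE K x : (k K x)%:E = mine `|upper_dini f x|%E K%:R%:E.
  rewrite fineK // ge0_fin_numE; last by rewrite le_min abse_ge0 lee_fin ler0n.
  by rewrite gt_min ltry orbT.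
have k0 K x : 0 <= k K x by rewrite -lee_fin kE le_min abse_ge0 lee_fin ler0n.
have kK K x : k K x <= K%:R by rewrite -lee_fin kE ge_min lexx orbT.
have kh K x : ((k K x)%:E <= `|upper_dini f x|)%E by rewrite kE ge_min lexx.
have mk K : measurable_fun setT (k K).
  apply/measurable_EFinP; rewrite (_ : _ \o _ = fun x => mine `|upper_dini f x|%E K%:R%:E).
    by apply: measurable_mine => //; exact: measurableT_comp.
  by apply/funext => x; rewrite /= kE.
have mcd : measurable (`[c, d]%classic : set R) by exact: measurable_itv.
have intk K : mu.-integrable `[c, d] (EFin \o k K).
  apply: measurable_bounded_integrable => //.
  - by rewrite /= lebesgue_measure_itv /=; case: ifP; rewrite -?EFinB ltry.
  - exact: (measurable_funTS (mk _)).
  - exists K%:R; split; first exact: num_real.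
    by move=> M KM x _ /=; rewrite ger0_norm // (le_trans (kK K x)) // ltW.
pose V x := sup [set S | var_sum f setT c x S].
have Vsup x : c <= x <= d -> has_sup [set S | var_sum f setT c x S].
  move=> /andP[cx xd]; split; first by exists 0; exact: var_sum0.
  by exists 1 => S /= vS; apply: vf; exact: var_sumS vS.
have Vinc x y : c <= x -> x <= y -> y <= d -> V x + `|f y - f x| <= V y.
  move=> cx xy yd; rewrite -lerBrDr; apply: ge_sup.
    by exists 0; exact: var_sum0.
  move=> S /= vS; rewrite lerBrDr; apply: ub_le_sup.
    by have [] := Vsup y; rewrite ?(le_trans cx) ?yd.
  by apply: var_sum_extend.
have step K : (\int[mu]_(x in `[c, d]) (k K x)%:E <= 1)%E.
  pose F x := - \int[mu]_(t in `[c, x]) k K t.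
  have acF : abs_continuous c d F.
    by apply: abs_continuousN; exact: abs_continuous_integral.
  have [N [mN N0 HN]] := ae_dquot_integral _ _ _ (intk K).
  have := nondecreasing_of_dquot V F c d N cd.
  have V0 : 0 <= V c.
    by apply: ub_le_sup; [have [] := Vsup c; rewrite ?lexx|exact: var_sum0].
  have V1 : V d <= 1.
    by apply: ge_sup; [exists 0; exact: var_sum0|move=> S; exact: vf].
  have -> : F c = 0 by rewrite /F set_itv1 Rintegral_set1 oppr0.
  rewrite -[X in (X <= _)%E]fineK; last exact: integrable_fin_num (intk K).
  rewrite -/(Rintegral mu `[c, d] (k K)) lee_fin => /(_ _ acF) H.
  suff : V c + 0 <= V d + F d by rewrite /F; lra.
  apply: H.
  - by exists N; split.
  - move=> x y cx xy yd; apply: le_trans (Vinc x y cx xy yd).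
    by rewrite lerDl.
  move=> x cxd Nx e e0 M.
  have e20 : 0 < e / 2 by rewrite divr_gt0.
  have /cvgrPdist_lt/(_ _ e20)[M1 _ HM1] :
      dquot (fun y => \int[mu]_(t in `[c, y]) k K t) x n @[n --> \oo] --> k K x.
    by apply: contrapT => Hx; apply: Nx; apply: HN => /= /(_ cxd).
  have xd : 0 < d - x by move: cxd; rewrite subr_gt0 => /andP[].
  have [M2 _ HM2] := near_infty_natSinv_lt (PosNum xd).
  have [n] := abs_upper_dini_ge f x (k K x) (e / 2) (maxn M (maxn M1 M2)) (kh K x) e20.
  rewrite !geq_max => /andP[Mn /andP[M1n M2n]] Hn; exists n => //.
  have := HM1 n M1n; have := HM2 n M2n.
  rewrite dquotD /F dquotN /=; set D := dquot (fun y => _) x n => xn.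
  rewrite ltr_norml => /andP[kD _].
  (* The increments of [V] dominate the absolute increments of [f], whose quotient is at least k x -
     e / 2 in absolute value for this n. *)
  suff : `|dquot f x n| <= dquot V x n by move: kD Hn; clear; lra.
  rewrite /dquot normrM [`|n.+1%:R|]ger0_norm // ler_pM2r //.
  rewrite lerBrDl; apply: Vinc.
  - by apply: ltW; case/andP: cxd.
  - by rewrite lerDl.
  - by rewrite -lerBrDl ltW.
(* The truncations increase to the absolute derivate, also where it is infinite, so monotone
   convergence transfers the bound. *)
have cvgk x : (k K x)%:E @[K --> \oo] --> `|upper_dini f x|%E.
  have := abse_ge0 (upper_dini f x); case E : `|upper_dini f x|%E => [r| |] // r0.
    apply: cvg_near_cst.
    exists (Num.truncn r).+1 => // n /= rn; rewrite kE E; apply/min_idPl.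
    rewrite lee_fin ltW // (lt_le_trans (truncnS_gt r)) // ler_nat //.
  rewrite (_ : (fun K => _) = (fun K => K%:R%:E)); last first.
    by apply/funext => K; rewrite kE E; apply/min_idPr; rewrite leey.
  by apply/cvgeryP; exact: cvgr_idn.
have -> : (\int[mu]_(x in `[c, d]) `|upper_dini f x| =
    \int[mu]_(x in `[c, d]) limn (fun K => (k K x)%:E))%E.
  by apply: eq_integral => x _; apply/esym/cvg_lim.
have ndk x : {homo (fun K => (k K x)%:E) : p q / (p <= q)%N >-> (p <= q)%E}.
  move=> p q pq; rewrite !kE le_min ge_min lexx /= ge_min lee_fin ler_nat pq orbT //.
rewrite monotone_convergence //.
- apply: lime_le; last by near=> K; exact: step.
  apply: ereal_nondecreasing_is_cvgn => p q pq.
  apply: ge0_le_integral => //.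
  + by move=> x _; rewrite lee_fin.
  + by apply/measurable_EFinP; exact: (measurable_funTS (mk _)).
  + by apply/measurable_EFinP; exact: (measurable_funTS (mk _)).
  + by move=> x _; exact: ndk.
- by move=> K; apply/measurable_EFinP; exact: (measurable_funTS (mk _)).
- by move=> K y _; rewrite lee_fin.
Unshelve. all: by end_near. Qed.

Lemma abs_continuousS F a b c d : a <= c -> d <= b ->
  abs_continuous a b F -> abs_continuous c d F.
Proof.
move=> ac db acF e e0; have [de d0 H] := acF e e0; exists de => // l s t h1 h2 h3.
apply: H => // i; have [? ? ?] := h1 i.
by split => //; [exact: le_trans ac _|exact: le_trans db].
Qed.

Lemma abs_continuousD F G a b : abs_continuous a b F -> abs_continuous a b G ->
  abs_continuous a b (F \+ G).
Proof.
move=> acF acG e e0; have e20 : 0 < e / 2 by rewrite divr_gt0.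
have [d1 d10 H1] := acF _ e20; have [d2 d20 H2] := acG _ e20.
exists (Num.min d1 d2); first by rewrite lt_min d10.
move=> l s t h1 h2; rewrite lt_min => /andP[h3 h4].
have := H1 l s t h1 h2 h3; have := H2 l s t h1 h2 h4 => G2 F2.
apply: (@le_lt_trans _ _ (\sum_i `|F (t i) - F (s i)| +
  \sum_i `|G (t i) - G (s i)|)); last lra.
rewrite -big_split /=; apply: ler_sum => i _.
by rewrite opprD addrACA; exact: ler_normD.
Qed.

(** On an interval shorter than the delta that absolute continuity assigns to 1, the variation is at
    most 1, and so is the integral of the absolute derivate. Finitely many intervals of length delta
    / 2 cover [a, b]. *)
Lemma integrable_upper_dini f a b : a <= b -> continuous f -> abs_continuous a b f ->
  mu.-integrable `[a, b] (upper_dini f).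
Proof.
move=> ab cf acf; have mh := measurable_upper_dini f cf.
apply/integrableP; split; first exact: (measurable_funTS mh).
have [d d0 Hd] := var_sum_lt f a b 1 acf ltr01.
have small x y : a <= x -> x <= y -> y <= b -> y - x < d ->
    (\int[mu]_(x in `[x, y]) `|upper_dini f x| <= 1)%E.
  move=> ax xy yb xyd; apply: upper_dini_integral_le => // S vS; apply: ltW.
  apply: (Hd setT x y) => //; rewrite setTI lebesgue_measure_itv /=.
  by case: ifP => _; rewrite -?EFinB lte_fin.
have d20 : 0 < d / 2 by rewrite divr_gt0.
have ind (j : nat) x : a <= x -> x <= b -> x <= a + j%:R * (d / 2) ->
    (\int[mu]_(t in `[a, x]) `|upper_dini f t| <= j%:R%:E)%E.
  elim: j x => [|j IH] x ax xb.
    rewrite mul0r addr0 => xa; have -> : x = a by apply/eqP; rewrite eq_le xa.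
    by rewrite set_itv1 integral_set1.
  move=> xj; have [xj'|xj'] := leP x (a + j%:R * (d / 2)).
    by apply: le_trans (IH x ax xb xj') _; rewrite lee_fin ler_nat.
  set y := a + j%:R * (d / 2) in xj'.
  have ay : a <= y by rewrite lerDl mulr_ge0 // ltW.
  have -> : `[a, x]%classic = `[a, y] `|` `]y, x].
    by apply: itv_bndbnd_setU; rewrite bnd_simp // ltW.
  have mabs D : measurable_fun D (fun t => `|upper_dini f t|%E).
    by apply: measurable_funTS; exact: measurableT_comp.
  rewrite ge0_integral_setU //=; last first.
    apply/disj_setPS => z [] /=; rewrite !in_itv /= => /andP[_ zy] /andP[yz _].
    by move: yz; rewrite ltNge zy.
  exact: mabs.
  rewrite -[X in (_ <= X%:E)%E]natr1 EFinD; apply: leeD.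
    by apply: IH => //; apply: le_trans (ltW xj') xb.
  rewrite integral_itv_obnd_cbnd //; apply: small => //; first exact: ltW.
  rewrite ltrBlDr; apply: le_lt_trans xj _.
  by rewrite /y -natr1; lra.
pose j := (Num.truncn ((b - a) / (d / 2))).+1.
apply: (@le_lt_trans _ _ j%:R%:E); last exact: ltry.
apply: ind => //; rewrite -lerBlDl -ler_pdivrMr //.
by rewrite ltW // truncnS_gt.
Qed.

(* Both f - int D and int D - f, where D = upper_dini f, satisfy the criterion of
   nondecreasing_of_dquot, so differentiability of f is not needed beforehand. *)
Lemma continuous_ftc f a b : a <= b -> continuous f -> abs_continuous a b f ->
  mu.-integrable `[a, b] (EFin \o (fun x => fine (upper_dini f x))) /\
  forall x, a <= x -> x <= b -> f x - f a = \int[mu]_(t in `[a, x]) fine (upper_dini f t).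
Proof.
move=> ab cf acf; have mh := measurable_upper_dini f cf.
have ih := integrable_upper_dini f a b ab cf acf.
pose k x := fine (upper_dini f x).
have mab : measurable (`[a, b]%classic : set R) by exact: measurable_itv.
have ik : mu.-integrable `[a, b] (EFin \o k).
  apply: le_integrable ih => //.
    by apply/measurable_EFinP; apply: measurable_funTS; exact: measurableT_comp.
  by move=> x _ /=; rewrite /k; case: (upper_dini f x) => [r| |] //=; rewrite normr0 leey.
split => // x ax xb.
have ikx : mu.-integrable `[a, x] (EFin \o k).
  by apply: integrableS ik => //; apply: subset_itv; rewrite bnd_simp.
have acI := abs_continuous_integral k a x ikx.
have acfx : abs_continuous a x f by exact: abs_continuousS acf.
set I := fun y => \int[mu]_(t in `[a, y]) k t in acI.
have Ia : I a = 0 by rewrite /I set_itv1 Rintegral_set1.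
(* Integrability makes the derivate finite almost everywhere, so [fine] takes its default value only
   on a null set. *)
have [N1 neg1 HN1] : exists2 N, mu.-negligible N & forall y, a < y < x -> ~ N y ->
    dquot I y n @[n --> \oo] --> k y /\ (k y)%:E = upper_dini f y.
  have [N1 [mN1 N10 HN1]] := ae_dquot_integral _ _ _ ikx.
  have [N2 [mN2 N20 HN2]] :
      {ae mu, forall x, `[a, b]%classic x -> upper_dini f x \is a fin_num}.
    by apply: (integrable_ae _ ih); exact: measurable_itv.
  exists (N1 `|` N2); first by apply: negligibleU; [exists N1|exists N2]; split.
  move=> y ayx Ny; split.
    by apply: contrapT => H; apply: Ny; left; apply: HN1 => /= /(_ ayx).
  rewrite /k fineK //; apply: contrapT => H; apply: Ny; right; apply: HN2 => /=.
  move=> /(_ _); rewrite in_itv /=; case/andP: ayx => ay yx.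
  by rewrite !ltW ?(lt_le_trans yx) // => /(_ isT).
(* The quotients of [f] are infinitely often at most k + e / 2 and infinitely often at least k - e /
   2; each fact serves one inequality. *)
apply/eqP; rewrite eq_le; apply/andP; split.
- have := nondecreasing_of_dquot (cst 0) (I \- f) a x N1 ax neg1.
  rewrite /= !add0r Ia sub0r -/(I x) => H.
  suff : - f a <= I x - f x by lra.
  apply: H => //.
    by apply: abs_continuousD => //; exact: abs_continuousN.
  move=> y ayx Ny e e0 M; have e20 : 0 < e / 2 by rewrite divr_gt0.
  have [/cvgrPdist_lt/(_ _ e20)[M1 _ HM1] kh] := HN1 y ayx Ny.
  have [|n] := @limn_esup_le_frequently (dquot f y) (k y) (e / 2) (maxn M M1) _ e20.
    by rewrite kh.
  rewrite geq_max => /andP[Mn M1n] Hn; exists n => //.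
  have := HM1 n M1n; rewrite ltr_norml => /andP[_ h].
  have -> : dquot (cst 0 \+ (I \- f)) y n = dquot I y n - dquot f y n.
    by rewrite /dquot /=; ring.
  lra.
- have := nondecreasing_of_dquot (cst 0) (f \- I) a x N1 ax neg1.
  rewrite /= !add0r Ia subr0 -/(I x) => H.
  suff : f a <= f x - I x by lra.
  apply: H => //.
    by apply: abs_continuousD => //; exact: abs_continuousN.
  move=> y ayx Ny e e0 M; have e20 : 0 < e / 2 by rewrite divr_gt0.
  have [/cvgrPdist_lt/(_ _ e20)[M1 _ HM1] kh] := HN1 y ayx Ny.
  have [|n] := @limn_esup_ge_frequently (dquot f y) (k y) (e / 2) (maxn M M1) _ e20.
    by rewrite kh.
  rewrite geq_max => /andP[Mn M1n] Hn; exists n => //.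
  have := HM1 n M1n; rewrite ltr_norml => /andP[h _].
  have -> : dquot (cst 0 \+ (f \- I)) y n = dquot f y n - dquot I y n.
    by rewrite /dquot /=; ring.
  lra.
Qed.

(** Composition with this projection onto [a, b] extends a function by its endpoint values, turning
    data on the interval into a continuous function on the line. *)
Definition clamp a b x := Num.max a (Num.min b x).

Lemma clampE a b x : a <= x -> x <= b -> clamp a b x = x.
Proof. by move=> ax xb; rewrite /clamp min_r // max_r. Qed.

Lemma clamp_itv a b x : a <= b -> a <= clamp a b x <= b.
Proof. by move=> ab; rewrite /clamp le_max lexx /= ge_max ab ge_min lexx. Qed.

(** The projection is monotone and 1-Lipschitz, so uniform continuity on [a, b] passes to the whole
    line. *)
Lemma continuous_clamp f a b : a <= b -> abs_continuous a b f ->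
  continuous (f \o clamp a b).
Proof.
move=> ab acf x; apply/cvgrPdist_lt => e e0.
have [d d0 H] := abs_continuous_uniform f a b e acf e0.
have {}H u v : `|u - v| < d -> `|f (clamp a b u) - f (clamp a b v)| < e.
  wlog vu : u v / v <= u => [hw|].
    have [?|/ltW uv] := leP v u; first exact: hw.
    by move=> uvd; rewrite distrC; apply: hw => //; rewrite distrC.
  rewrite ger0_norm ?subr_ge0 // => uvd.
  have /andP[au ub] := clamp_itv a b u ab; have /andP[av vb] := clamp_itv a b v ab.
  have m1 : Num.min b v <= Num.min b u /\ Num.min b u - Num.min b v <= u - v.
    by rewrite !minEle; case: (leP b u) => ?; case: (leP b v) => ?; split; lra.
  have m2 (p q : R) : q <= p ->
      Num.max a q <= Num.max a p /\ Num.max a p - Num.max a q <= p - q.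
    move=> qp.
    by rewrite !maxEle; case: (leP a p) => ?; case: (leP a q) => ?; split; lra.
  have [? ?] := m2 _ _ m1.1.
  by apply: H => //; rewrite /clamp; lra.
near=> y; apply: H; near: y; exact: cvgr_dist_lt.
Unshelve. all: by end_near. Qed.

(** The result for continuous functions is applied to the clamped extension, which agrees with [f]
    near every interior point. *)
Lemma abs_continuous_ftc f a b : a <= b -> abs_continuous a b f ->
  exists k : R -> R, [/\ mu.-integrable `[a, b] (EFin \o k),
    forall x, a <= x -> x <= b -> f x - f a = \int[mu]_(t in `[a, x]) k t &
    {ae mu, forall x, a < x < b -> is_derive x 1 f (k x)}].
Proof.
move=> ab acf; pose g := f \o clamp a b.
have gf x : a <= x -> x <= b -> g x = f x by move=> ax xb; rewrite /g /= clampE.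
have acg : abs_continuous a b g.
  move=> e e0; have [d d0 H] := acf e e0; exists d => // l s t h1 h2 h3.
  rewrite (eq_bigr (fun i => `|f (t i) - f (s i)|)); first exact: H.
  move=> i _; have [? ? ?] := h1 i.
  by rewrite !gf //;
    [exact: le_trans (_ : s i <= t i) _|exact: le_trans (_ : s i <= t i)].
have [ik fk] := continuous_ftc g a b ab (continuous_clamp f a b ab acf) acg.
set k := fun x => fine (upper_dini g x) in ik.
exists k; split => //.
  by move=> x ax xb; rewrite -fk // !gf.
have := ae_is_derive_integral _ _ _ ik.
apply: filterS; first exact: (ae_filter_ringOfSetsType mu).
move=> x H axb; have := H axb; case/andP: axb => ax xb xI.
have : is_derive x 1 (fun y => f a + \int[mu]_(t in `[a, y]) k t) (k x).
  by rewrite -[k x]add0r; apply: is_deriveD.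
apply: near_eq_is_derive; near=> y.
have yb : y <= b by apply: ltW; near: y; exact: lt_nbhsl.
have ay : a <= y by apply: ltW; near: y; exact: lt_nbhsr.
by rewrite -fk // !gf // subrKC.
Unshelve. all: by end_near. Qed.

End AbsoluteContinuity.

(** * L2 and H1 functions *)

Section FunctionSpaces.
Context {R : realType}.
Local Notation mu := (@lebesgue_measure R).
Implicit Types (f g F G V : R -> R) (a b x y : R).

(** The Cauchy form avoids the unknown limit, and its outer quantifiers range over natural numbers;
    the set of differentiability thus becomes a countable intersection of countable unions. *)
Lemma derivable_cauchy f x : derivable f x 1 <->
  forall k : nat, exists j : nat, forall p : R * R,
    0 < `|p.1| < j.+1%:R^-1 -> 0 < `|p.2| < j.+1%:R^-1 ->
    `|(f (p.1 + x) - f x) / p.1 - (f (p.2 + x) - f x) / p.2| <= k.+1%:R^-1.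
Proof.
pose q (h : R) : R := (f (h + x) - f x) / h.
have -> : derivable f x 1 = cvg (q @ 0^').
  have qE : (fun h : R => h^-1 *: ((f \o shift x) (h *: 1) - f x)) = q.
    by apply/funext => h; rewrite /q /GRing.scale /= mulr1 mulrC.
  by rewrite -qE.
split.
- move=> /cvg_ex[l] /cvgrPdist_lt H k.
  have k0 : 0 < (k.+1%:R^-1 / 2 : R) by rewrite divr_gt0.
  have [r /= r0 Hr] := H _ k0.
  have [j _ Hj] := near_infty_natSinv_lt (PosNum r0).
  exists j => -[h1 h2] /= /andP[h10 h1j] /andP[h20 h2j].
  have H1 (h : R) : 0 < `|h| -> `|h| < j.+1%:R^-1 -> `|l - q h| < k.+1%:R^-1 / 2.
    move=> h0 hj; apply: Hr; last by rewrite -normr_gt0.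
    by rewrite /= sub0r normrN (lt_trans hj) //; exact: Hj (leqnn _).
  have -> : (f (h1 + x) - f x) / h1 - (f (h2 + x) - f x) / h2 =
    (l - q h2) - (l - q h1) by rewrite /q; ring.
  apply: le_trans (ler_normB _ _) _.
  have := H1 _ h10 h1j; have := H1 _ h20 h2j.
  rewrite [leRHS]splitr; move: (`|_|) (`|_|) (_ / 2) => u v w; lra.
- move=> H; apply/cauchy_cvgP; apply: cauchy_exP => e e0.
  have [k _ Hk] := near_infty_natSinv_lt (PosNum e0).
  have [j Hj] := H k.
  exists (q (j.+1%:R^-1 / 2)); rewrite nbhs_simpl /=.
  have j0 : 0 < (j.+1%:R^-1 : R) by rewrite invr_gt0.
  exists j.+1%:R^-1 => // h /=; rewrite sub0r normrN => hj h0.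
  rewrite /ball /=; apply: le_lt_trans (Hk k (leqnn _)).
  apply: (Hj (_, _)) => /=.
    by rewrite gtr0_norm ?divr_gt0 //= ltr_pdivrMr // ltr_pMr // ltr1n.
  by rewrite normr_gt0 h0.
Qed.

(* For fixed k and j the Cauchy condition above defines a closed set of x, because
   it is an intersection over all pairs of increments. *)
Lemma measurable_derivable f : continuous f ->
  measurable ([set x | derivable f x 1] : set R).
Proof.
move=> cf.
pose C (k j : nat) : set R := [set x | forall p : R * R,
    0 < `|p.1| < j.+1%:R^-1 -> 0 < `|p.2| < j.+1%:R^-1 ->
    `|(f (p.1 + x) - f x) / p.1 - (f (p.2 + x) - f x) / p.2| <= k.+1%:R^-1].
rewrite (_ : [set x | _] = \bigcap_k \bigcup_j C k j); last first.
  apply/seteqP; split => x /=.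
    by move=> /derivable_cauchy H k _; have [j Hj] := H k; exists j.
  by move=> H; apply/derivable_cauchy => k; have [j _ Hj] := H k I; exists j.
apply: bigcap_measurable => // k _; apply: bigcup_measurable => j _.
apply: measurable_realfun.closed_measurable.
rewrite (_ : C k j = \bigcap_(p in [set p : R * R | 0 < `|p.1| < j.+1%:R^-1 /\
    0 < `|p.2| < j.+1%:R^-1]) [set x | `|(f (p.1 + x) - f x) / p.1 -
    (f (p.2 + x) - f x) / p.2| <= k.+1%:R^-1]); last first.
  apply/seteqP; split => x /=.
    by move=> H p /= [p1 p2]; exact: H.
  by move=> H p p1 p2; apply: (H p).
apply: closed_bigI => p _.
pose h x := `|(f (p.1 + x) - f x) / p.1 - (f (p.2 + x) - f x) / p.2|.
have ch : continuous h.
  have cq (c : R) : continuous (fun x => (f (c + x) - f x) / c).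
    move=> x; apply: cvgM; last exact: cvg_cst.
    apply: cvgB; last exact: cf.
    apply: (@continuous_comp _ _ _ (fun x => c + x) f); last exact: cf.
    by apply: cvgD; [exact: cvg_cst|exact: cvg_id].
  by move=> x; apply: cvg_norm; apply: cvgB; exact: cq.
exact: (proj1 (continuous_closedP _) ch _ (@closed_le _ _)).
Qed.

(** Where [f] is differentiable, the quotients converge to [derive1 f]; elsewhere the indicator
    factor produces the default value 0 of [derive1]. *)
Lemma measurable_derive1 f : continuous f -> measurable_fun setT (derive1 f).
Proof.
move=> cf; have mD := measurable_derivable f cf.
set D := [set x | _] in mD.
apply: (@measurable_fun_cvg _ _ _ _ (fun n x => dquot f x n * \1_D x)).
  move=> n; apply: measurable_funM; last exact: measurable_indic.
  apply: measurable_funM => //.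
apply: measurable_funB; last exact: continuous_measurable_fun.
  apply: (measurableT_comp (continuous_measurable_fun cf)).
  by apply: measurable_funD.
move=> x _; rewrite indicE; have [xD|xD] := boolP (x \in D).
  under eq_fun do rewrite mulr1.
  by apply: dquot_cvg; exact: set_mem xD.
under eq_fun do rewrite mulr0.
have -> : derive1 f x = 0.
  rewrite derive1E /derive dvgP // => H; move: xD => /negP; apply.
  by rewrite inE /D.
exact: cvg_cst.
Qed.

(** * Square-integrable functions *)

Lemma integrable_sq f a b : L2 a b f ->
  measurable_fun `[a, b] f /\ mu.-integrable `[a, b] (EFin \o (fun x => f x ^+ 2)).
Proof.
move=> Lf; split.
  have : measurable_fun setT (f \_ `[a, b]).
    by move: Lf; rewrite /L2 inE => /andP[/[!inE]].
  by move=> /(measurable_restrictT _ (measurable_itv _)).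
rewrite integrable_mkcond //= restrict_EFin.
have := Lfun2_integrable_sqr Lf; congr (is_true (integrable _ _ (_ \o _))).
by apply/funext => x /=; rewrite !patchE; case: ifP => // _; rewrite expr0n.
Qed.

Lemma L2_of_integrable_sq f a b : measurable_fun `[a, b] f ->
  mu.-integrable `[a, b] (EFin \o (fun x => f x ^+ 2)) -> L2 a b f.
Proof.
move=> mf if2; have mf' : measurable_fun setT (f \_ `[a, b]).
  by apply/(measurable_restrictT _ (measurable_itv _)).
rewrite /L2 inE; apply/andP; split; rewrite inE //=.
rewrite /finite_norm unlock /=; apply: poweR_lty.
move: if2; rewrite integrable_mkcond //= restrict_EFin => /integrable_lty.
move=> /(_ measurableT); apply: le_lt_trans.
rewrite le_eqVlt; apply/orP; left; apply/eqP; apply: eq_integral => x _ /=.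
rewrite !patchE; case: ifP => _; last by rewrite normr0 powR_mulrn // expr0n.
by rewrite powR_mulrn // real_normK ?num_real.
Qed.

Lemma L2_dominated f (g : R -> R) a b : measurable_fun `[a, b] f ->
  mu.-integrable `[a, b] (EFin \o g) -> (forall x, a <= x <= b -> f x ^+ 2 <= g x) ->
  L2 a b f.
Proof.
move=> mf ig fg; apply: L2_of_integrable_sq => //.
apply: le_integrable ig => //.
  by apply/measurable_EFinP; exact: measurable_funX.
move=> x /=; rewrite in_itv /= => xab; rewrite lee_fin ger0_norm ?sqr_ge0 //.
by apply: le_trans (ler_norm _); exact: fg.
Qed.

(** The product is dominated by f^2 + g^2, because (f + g)^2 and (f - g)^2 are nonnegative. *)
Lemma L2_mul_integrable f g a b : L2 a b f -> L2 a b g ->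
  mu.-integrable `[a, b] (EFin \o (fun x => f x * g x)).
Proof.
move=> /integrable_sq[mf if2] /integrable_sq[mg ig2].
apply: (@le_integrable _ _ _ mu _ (measurable_itv _) _
  (EFin \o (fun x => f x ^+ 2 + g x ^+ 2))).
- by apply/measurable_EFinP; exact: measurable_funM.
- move=> x _ /=; rewrite lee_fin [leRHS]ger0_norm ?addr_ge0 ?sqr_ge0 //.
  rewrite ler_norml; apply/andP; split.
    have := sqr_ge0 (f x + g x); nra.
  have := sqr_ge0 (f x - g x); nra.
- by apply: eq_integrable (integrableD _ if2 ig2).
Qed.

Lemma L2_cst c a b : L2 a b (fun=> c).
Proof.
apply: L2_of_integrable_sq => //.
apply: measurable_bounded_integrable => //.
- by rewrite /= lebesgue_measure_itv /=; case: ifP; rewrite -?EFinB ltry.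
- exists (c ^+ 2); split; first exact: num_real.
  by move=> M cM x _ /=; rewrite ger0_norm ?sqr_ge0 // ltW.
Qed.

Lemma L2_integrable f a b : L2 a b f -> mu.-integrable `[a, b] (EFin \o f).
Proof.
move=> Lf; apply: eq_integrable (L2_mul_integrable _ _ _ _ Lf (L2_cst 1 a b)).
  exact: measurable_itv.
by move=> x _ /=; rewrite mulr1.
Qed.

Lemma L2D f g a b : L2 a b f -> L2 a b g -> L2 a b (fun x => f x + g x).
Proof.
move=> Lf Lg.
have [mf if2] := integrable_sq _ _ _ Lf; have [mg ig2] := integrable_sq _ _ _ Lg.
apply: (L2_dominated _ (fun x => 2 * (f x ^+ 2 + g x ^+ 2))).
- exact: measurable_funD.
- by apply: eq_integrable (integrableZl _ 2 (integrableD _ if2 ig2)).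
- by move=> x _; have := sqr_ge0 (f x - g x); nra.
Qed.

Lemma L2Z c f a b : L2 a b f -> L2 a b (fun x => c * f x).
Proof.
move=> Lf; have [mf if2] := integrable_sq _ _ _ Lf.
apply: (L2_dominated _ (fun x => c ^+ 2 * f x ^+ 2)).
- exact: measurable_funM.
- by apply: eq_integrable (integrableZl _ (c ^+ 2) if2).
- by move=> x _; rewrite exprMn.
Qed.

Lemma L2N f a b : L2 a b f -> L2 a b (fun x => - f x).
Proof.
by move=> /(L2Z (-1)); congr L2; apply/funext => x; rewrite mulN1r.
Qed.

Lemma L2B f g a b : L2 a b f -> L2 a b g -> L2 a b (fun x => f x - g x).
Proof. by move=> Lf Lg; apply: L2D => //; exact: L2N. Qed.

Lemma L2_sum (I : finType) (f : I -> R -> R) a b : (forall i, L2 a b (f i)) ->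
  L2 a b (fun x => \sum_i f i x).
Proof.
move=> Lf; elim: (index_enum I) => [|i s IH].
  by under eq_fun do rewrite big_nil; exact: L2_cst.
by under eq_fun do rewrite big_cons; exact: L2D.
Qed.

Lemma ae_itv_open a b (P : R -> Prop) :
  {ae mu, forall x, a < x < b -> P x} -> {ae mu, forall x, x \in `[a, b] -> P x}.
Proof.
move=> [N [mN N0 HN]].
have n1 (c : R) : mu.-negligible [set c].
  by apply/negligibleP; [exact: measurable_set1|exact: lebesgue_measure_set1].
have nN : mu.-negligible N by exists N; split.
apply: negligibleS (negligibleU nN (negligibleU (n1 a) (n1 b))).
move=> x /= /not_implyP[]; rewrite in_itv /= => /andP[].
  rewrite le_eqVlt => /orP[/eqP <- _ _|ax]; first by right; left.
  rewrite le_eqVlt => /orP[/eqP -> _|xb Px]; first by right; right.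
  by left; apply: HN => /=; rewrite ax xb => /(_ isT).
Qed.

Lemma ae_eq_Rintegral_itv (f g : R -> R) a b :
  mu.-integrable `[a, b] (EFin \o f) -> measurable_fun `[a, b] g ->
  {ae mu, forall x, x \in `[a, b] -> f x = g x} ->
  \int[mu]_(x in `[a, b]) f x = \int[mu]_(x in `[a, b]) g x.
Proof.
move=> /integrableP[mf _] mg fg; congr fine; apply: ae_eq_integral => //.
- exact/measurable_EFinP.
- apply: filterS fg; first exact: (ae_filter_ringOfSetsType mu).
  by move=> x /= H xab; rewrite H.
Qed.

(** * Integration by parts and Riesz representers *)

Lemma abs_continuous_bounded f a b : a <= b -> abs_continuous a b f ->
  exists2 M, 0 < M & forall x, a <= x <= b -> `|f x| <= M.
Proof.
move=> ab acf; pose g := f \o clamp a b.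
have cg : continuous g := continuous_clamp f a b ab acf.
have cn : {within `[a, b], continuous (fun x => `|g x|)}.
  by apply: continuous_subspaceT => x; apply: cvg_norm; exact: cg.
have [c _ cM] := EVT_max ab cn.
exists (`|g c| + 1); first by rewrite ltr_wpDl.
move=> x xab; have := cM x; rewrite in_itv /= xab => /(_ isT).
case/andP: xab => ax xb; rewrite /g /= clampE // => /le_trans; apply.
by rewrite lerDl.
Qed.

Lemma abs_continuous_L2 f a b : a <= b -> abs_continuous a b f -> L2 a b f.
Proof.
move=> ab acf; have cf := continuous_clamp f a b ab acf.
have [M M0 fM] := abs_continuous_bounded f a b ab acf.
apply: (L2_dominated _ (fun=> M ^+ 2)).
- apply: (@eq_measurable_fun _ _ _ _ _ (f \o clamp a b)).
    by move=> x /set_mem /=; rewrite in_itv /= => /andP[ax xb]; rewrite clampE.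
  exact: (measurable_funTS (continuous_measurable_fun cf)).
- exact: L2_integrable (L2_cst _ _ _).
- move=> x /fM fxM.
  by rewrite -[leLHS]real_normK ?num_real // ler_pXn2r ?nnegrE // ltW.
Qed.

(** The increment of the product is the increment of [F] times a value of [G] plus the increment of
    [G] times a value of [F]. The bounds M and K of the two functions fix the tolerances e / 2 / K
    and e / 2 / M. *)
Lemma abs_continuousM F G a b : a <= b -> abs_continuous a b F ->
  abs_continuous a b G -> abs_continuous a b (fun x => F x * G x).
Proof.
move=> ab acF acG e e0.
have [M M0 FM] := abs_continuous_bounded F a b ab acF.
have [K K0 GK] := abs_continuous_bounded G a b ab acG.
have eK : 0 < e / 2 / K by rewrite !divr_gt0.
have eM : 0 < e / 2 / M by rewrite !divr_gt0.
have [d1 d10 H1] := acF _ eK; have [d2 d20 H2] := acG _ eM.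
exists (Num.min d1 d2); first by rewrite lt_min d10.
move=> l s t h1 h2; rewrite lt_min => /andP[h3 h4].
have := H1 l s t h1 h2 h3; have := H2 l s t h1 h2 h4.
rewrite !ltr_pdivlMr // => G2 F2.
apply: (@le_lt_trans _ _ ((\sum_i `|F (t i) - F (s i)|) * K +
  (\sum_i `|G (t i) - G (s i)|) * M)); last lra.
rewrite !mulr_suml -big_split /=; apply: ler_sum => i _.
have [asi siti tib] := h1 i.
have -> : F (t i) * G (t i) - F (s i) * G (s i) =
  (F (t i) - F (s i)) * G (t i) + (G (t i) - G (s i)) * F (s i) by ring.
apply: le_trans (ler_normD _ _) _; rewrite !normrM lerD // ler_wpM2l //.
  by apply: GK; rewrite tib (le_trans asi).
by apply: FM; rewrite asi (le_trans siti).
Qed.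

Lemma H1_L2 f a b : a <= b -> H1 a b f -> L2 a b f.
Proof. by move=> ab [acf _]; exact: abs_continuous_L2. Qed.

Lemma H1_ae_derivable f a b : a <= b -> H1 a b f ->
  {ae mu, forall x, a < x < b -> is_derive x 1 f (derive1 f x)}.
Proof.
move=> ab [acf _]; have [k [_ _]] := abs_continuous_ftc f a b ab acf.
apply: filterS; first exact: (ae_filter_ringOfSetsType mu).
by move=> x H axb; have [dF F'] := H axb; split => //; rewrite derive1E.
Qed.

(** The product is absolutely continuous, so its boundary difference is the integral of its almost
    everywhere derivative, which the product rule identifies. *)
Lemma H1_integration_by_parts f g a b : a <= b -> H1 a b f -> H1 a b g ->
  \int[mu]_(x in `[a, b]) (derive1 f x * g x) +
  \int[mu]_(x in `[a, b]) (f x * derive1 g x) =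
  f b * g b - f a * g a.
Proof.
move=> ab hf hg; have [acf L2f'] := hf; have [acg L2g'] := hg.
have i1 := L2_mul_integrable _ _ _ _ L2f' (H1_L2 _ _ _ ab hg).
have i2 := L2_mul_integrable _ _ _ _ (H1_L2 _ _ _ ab hf) L2g'.
have [k [ik Fk dk]] := abs_continuous_ftc _ a b ab (abs_continuousM f g a b ab acf acg).
rewrite -RintegralD //.
rewrite (Fk b ab (lexx _)); apply/esym; apply: ae_eq_Rintegral_itv => //.
  apply: measurable_funD.
    by have /integrableP[/measurable_EFinP] := i1.
  by have /integrableP[/measurable_EFinP] := i2.
apply: ae_itv_open.
have := H1_ae_derivable f a b ab hf; have := H1_ae_derivable g a b ab hg.
move: dk; apply: filterS3; first exact: (ae_filter_ringOfSetsType mu).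
move=> x Hk Hg Hf axb.
have [_ <-] := Hk axb; have [dg Dg] := Hg axb; have [df Df] := Hf axb.
rewrite -[in RHS]Dg -[in RHS]Df.
have := @deriveM _ _ f g x 1 df dg.
rewrite /GRing.scale /= => ->; ring.
Qed.

Lemma H1_cst (c : R) a b : H1 a b (fun=> c).
Proof.
split.
  move=> e e0; exists 1 => // l s t _ _ _.
  by rewrite big1 // => i _; rewrite subrr normr0.
have -> : derive1 (fun=> c) = (fun=> 0) :> (R -> R); last exact: L2_cst.
by apply/funext => x; exact: derive1_cst.
Qed.

Lemma H1_ftc f a b : a <= b -> H1 a b f ->
  \int[mu]_(x in `[a, b]) derive1 f x = f b - f a.
Proof.
move=> ab hf; have := H1_integration_by_parts f (fun=> 1) a b ab hf (H1_cst 1 a b).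
rewrite !mulr1 => <-.
rewrite [X in _ = _ + X](_ : _ = 0) ?addr0.
  by apply: eq_Rintegral => x _; rewrite mulr1.
under eq_Rintegral => x _ do rewrite derive1_cst mulr0.
by rewrite Rintegral_cst ?mul0r //; exact: measurable_itv.
Qed.

(** The indefinite integral is clamped to be continuous on the whole line, from which the
    measurability of [derive1 psi] follows. *)
Lemma H1_primitive (h : R -> R) a b : a <= b -> L2 a b h ->
  exists psi : R -> R, [/\ H1 a b psi,
    forall x, a <= x <= b -> psi x = \int[mu]_(t in `[a, x]) h t &
    {ae mu, forall x, x \in `[a, b] -> derive1 psi x = h x}].
Proof.
move=> ab Lh; have ih := L2_integrable _ _ _ Lh.
pose I x := \int[mu]_(t in `[a, x]) h t.
have acI : abs_continuous a b I by exact: abs_continuous_integral.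
pose psi := I \o clamp a b.
have psiE x : a <= x <= b -> psi x = I x by move=> /andP[ax xb]; rewrite /psi /= clampE.
have cpsi : continuous psi := continuous_clamp I a b ab acI.
have dpsi : {ae mu, forall x, x \in `[a, b] -> derive1 psi x = h x}.
  apply: ae_itv_open; have := ae_is_derive_integral _ _ _ ih.
  apply: filterS; first exact: (ae_filter_ringOfSetsType mu).
  move=> x H axb; have := H axb; case/andP: axb => ax xb xI.
  suff [_] : is_derive x 1 psi (h x) by rewrite derive1E.
  apply: near_eq_is_derive xI; near=> y.
  have yb : y <= b by apply: ltW; near: y; exact: lt_nbhsl.
  have ay : a <= y by apply: ltW; near: y; exact: lt_nbhsr.
  by rewrite psiE ?ay.
exists psi; split => //; split.
  move=> e e0; have [d d0 H] := acI e e0; exists d => // l s t h1 h2 h3.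
  rewrite (eq_bigr (fun i => `|I (t i) - I (s i)|)); first exact: H.
  move=> i _; have [asi siti tib] := h1 i.
  have ati := le_trans asi siti; have sib := le_trans siti tib.
  by rewrite !psiE //; exact/andP.
have [mh ih2] := integrable_sq _ _ _ Lh.
have mpsi : measurable_fun `[a, b] (derive1 psi).
  exact: (measurable_funTS (measurable_derive1 psi cpsi)).
apply: L2_of_integrable_sq => //.
have /integrableP[_ fin] := ih2; apply/integrableP; split.
  by apply/measurable_EFinP; exact: measurable_funX.
apply: le_lt_trans fin; rewrite le_eqVlt; apply/orP; left; apply/eqP.
apply: ae_eq_integral => //.
- by apply: measurableT_comp => //; apply/measurable_EFinP; exact: measurable_funX.
- by apply: measurableT_comp => //; apply/measurable_EFinP; exact: measurable_funX.
- apply: filterS dpsi; first exact: (ae_filter_ringOfSetsType mu).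
  by move=> x H xab /=; rewrite H.
Unshelve. all: by end_near. Qed.

(* psi' = c - G, where G' = g and c is the mean of G. *)
Lemma H10_representer (T : R) (g : R -> R) : 0 < T -> L2 0 T g ->
  exists2 psi, H10 0 T psi & forall phi, H10 0 T phi ->
    \int[mu]_(t in `[0, T]) (phi t * g t) =
    \int[mu]_(t in `[0, T]) (derive1 phi t * derive1 psi t).
Proof.
move=> T0 Lg; have T0' := ltW T0.
have [G [hG _ dG]] := H1_primitive g 0 T T0' Lg.
have LG := H1_L2 _ _ _ T0' hG.
pose c := (\int[mu]_(t in `[0, T]) G t) / T.
pose h t := c - G t.
have Lh : L2 0 T h by apply: L2B => //; exact: L2_cst.
have [psi [hpsi psiE dpsi]] := H1_primitive h 0 T T0' Lh.
have iG := L2_integrable _ _ _ LG.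
have ic := L2_integrable _ _ _ (L2_cst c 0 T).
exists psi.
  split => //.
    by rewrite psiE ?lexx // set_itv1 Rintegral_set1.
  (* The mean c makes the integral of h vanish, which is the condition psi T = 0. *)
  rewrite psiE ?lexx ?T0' // RintegralB // Rintegral_cst //.
  rewrite /= lebesgue_measure_itv /= lte_fin T0 -EFinB /= subr0.
  by rewrite /c divfK ?subrr // gt_eqF.
move=> phi [hphi phi0 phiT].
have [acphi Ldphi] := hphi.
have [_ LdG] := hG; have [_ Ldpsi] := hpsi.
have Lphi := H1_L2 _ _ _ T0' hphi.
have m2 f g' : L2 0 T f -> L2 0 T g' -> measurable_fun `[0, T] (fun t => f t * g' t).
  move=> Lf Lg'.
  by have /integrableP[/measurable_EFinP] := L2_mul_integrable _ _ _ _ Lf Lg'.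
transitivity (\int[mu]_(t in `[0, T]) (phi t * derive1 G t)).
  apply: ae_eq_Rintegral_itv; first exact: L2_mul_integrable.
    exact: m2.
  apply: filterS dG; first exact: (ae_filter_ringOfSetsType mu).
  by move=> t Ht tT; rewrite Ht.
(* The boundary terms vanish, leaving - int phi' G; the constant c may be added because int phi' =
   0. *)
have := H1_integration_by_parts phi G 0 T T0' hphi hG.
rewrite phi0 phiT !mul0r subr0 => /eqP; rewrite addrC addr_eq0 => /eqP ->.
transitivity (\int[mu]_(t in `[0, T]) (derive1 phi t * h t)); last first.
  apply: ae_eq_Rintegral_itv; first exact: L2_mul_integrable.
    exact: m2.
  apply: filterS dpsi; first exact: (ae_filter_ringOfSetsType mu).
  by move=> t Ht tT; rewrite Ht.
under [RHS]eq_Rintegral => t _ do rewrite /h mulrBr.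
rewrite RintegralB //.
- rewrite RintegralZr ?H1_ftc ?phi0 ?phiT ?subrr ?mul0r ?sub0r //.
  exact: L2_integrable.
- exact: L2_mul_integrable _ _ _ _ Ldphi (L2_cst c 0 T).
- exact: L2_mul_integrable.
Qed.

End FunctionSpaces.

(** * Adjoints and Gramians *)

Section Adjoints.
Context {R : realType} {N : nat} (tau : 'I_N -> R) (tau_gt0 : forall k, 0 < tau k).
Local Notation mu := (@lebesgue_measure R).
Local Notation op d := (('I_N -> R -> R) -> 'cV[R]_d).

(** Existence of the Riesz representers ensures that [adjoint] does not return its default value;
    the Gramian identities rest on this property alone. *)
Definition has_adjoint {d} (T : op d) : Prop := forall v : 'cV[R]_d,
  exists psi, Htau tau psi /\
    forall phi, Htau tau phi -> ((T phi)^T *m v) 0 0 = Htau_inner tau phi psi.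

Lemma adjointP {d} (T : op d) v : has_adjoint T ->
  Htau tau (adjoint tau T v) /\
  forall phi, Htau tau phi -> ((T phi)^T *m v) 0 0 = Htau_inner tau phi (adjoint tau T v).
Proof. by move=> /(_ v) H; exact: (xgetPex (fun _ _ => 0) H). Qed.

Lemma Htau_innerC phi psi : Htau_inner tau phi psi = Htau_inner tau psi phi.
Proof.
by apply: eq_bigr => k _; apply: eq_Rintegral => t _; rewrite mulrC.
Qed.

(** The matrix of S T^*, an intermediate form that allows the two factors of a Gramian to be
    exchanged separately. *)
Definition cross_gramian {d e} (S : op d) (T : op e) : 'M[R]_(d, e) :=
  \matrix_(i, j) S (adjoint tau T (delta_mx j 0)) i 0.

Lemma cross_gramianE {d e} (S : op d) (T : op e) i j : has_adjoint S -> has_adjoint T ->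
  cross_gramian S T i j =
  Htau_inner tau (adjoint tau T (delta_mx j 0)) (adjoint tau S (delta_mx i 0)).
Proof.
move=> aS aT; have [hT _] := adjointP T (delta_mx j 0) aT.
have [_ <-//] := adjointP S (delta_mx i 0) aS.
by rewrite -colE !mxE.
Qed.

Lemma cross_gramian_tr {d e} (S : op d) (T : op e) : has_adjoint S -> has_adjoint T ->
  (cross_gramian S T)^T = cross_gramian T S.
Proof.
move=> aS aT; apply/matrixP => i j.
by rewrite mxE (cross_gramianE S T j i aS aT) (cross_gramianE T S i j aT aS) Htau_innerC.
Qed.

(** The columns are values at T^* e_j, which lies in [Htau], so an identity on [Htau] suffices. *)
Lemma cross_gramian_mull {d e f c} (S : op d) (S' : op e) (T : op f)
    (P : 'M[R]_(c, d)) (Q : 'M[R]_(c, e)) : has_adjoint T ->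
  (forall phi, Htau tau phi -> P *m S phi = Q *m S' phi) ->
  P *m cross_gramian S T = Q *m cross_gramian S' T.
Proof.
move=> aT PQ; apply/matrixP => i j.
have [hT _] := adjointP T (delta_mx j 0) aT.
have /matrixP/(_ i 0) := PQ _ hT; rewrite !mxE => H.
under eq_bigr do rewrite mxE; under [RHS]eq_bigr do rewrite mxE.
exact: H.
Qed.

(** The operators are exchanged one side at a time: P S S^* = Q T S^*, then transposition turns T
    S^* into S T^* and the same exchange applies. *)
Lemma gramian_congr {d e c} (S : op d) (T : op e) (P : 'M[R]_(c, d)) (Q : 'M[R]_(c, e)) :
  has_adjoint S -> has_adjoint T ->
  (forall phi, Htau tau phi -> P *m S phi = Q *m T phi) ->
  P *m gramian tau S *m P^T = Q *m gramian tau T *m Q^T.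
Proof.
move=> aS aT PQ; rewrite -/(cross_gramian S S) -/(cross_gramian T T).
rewrite (cross_gramian_mull S T S P Q aS PQ).
rewrite -mulmxA -(trmxK (cross_gramian T S)) cross_gramian_tr // -trmx_mul.
by rewrite (cross_gramian_mull S T T P Q aT PQ) trmx_mul cross_gramian_tr // mulmxA.
Qed.

(** The common form of the noise operator and, on [Htau], of the data operator. *)
Definition int_op {d} (w : 'I_N -> R -> 'cV[R]_d) : op d := fun phi =>
  \sum_k integralv 0 (tau k) (fun t => phi k t *: w k t).

Lemma Htau_L2 phi k : Htau tau phi -> L2 0 (tau k) (phi k).
Proof. by move=> /(_ k)[h _ _]; apply: H1_L2 h; exact: ltW. Qed.

Lemma L2v_mulmx {d e} (M : 'M[R]_(e, d)) a b (f : R -> 'cV[R]_d) : L2v a b f ->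
  L2v a b (fun t => M *m f t).
Proof.
move=> Lf i; under eq_fun do rewrite mxE.
by apply: L2_sum => j; apply: L2Z; exact: Lf.
Qed.

Lemma mulmx_integralv {d e} (M : 'M[R]_(e, d)) a b (f : R -> 'cV[R]_d) :
  (forall i, mu.-integrable `[a, b] (EFin \o (fun t => f t i 0))) ->
  M *m integralv a b f = integralv a b (fun t => M *m f t).
Proof.
move=> intf; apply/matrixP => i j; rewrite !mxE.
under [RHS]eq_Rintegral do rewrite mxE.
under eq_bigr do rewrite mxE.
elim: (index_enum _) => [|k s IH].
  rewrite big_nil; under eq_Rintegral do rewrite big_nil.
  by rewrite Rintegral_cst ?mul0r.
rewrite big_cons IH; under [RHS]eq_Rintegral do rewrite big_cons.
rewrite RintegralD //.
- by rewrite RintegralZl.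
- by apply: eq_integrable (integrableZl _ (M i k) (intf k)).
- elim: s {IH} => [|l s IH].
    apply: eq_integrable (L2_integrable _ _ _ (L2_cst 0 a b)) => // t _.
    by rewrite /= big_nil.
  apply: eq_integrable (integrableD _ (integrableZl _ (M i l) (intf l)) IH) => // t _.
  by rewrite /= big_cons.
Qed.

Lemma L2_scale_integrable {d} a b (f : R -> R) (w : R -> 'cV[R]_d) i j :
  L2 a b f -> L2v a b w -> mu.-integrable `[a, b] (EFin \o (fun t => (f t *: w t) i j)).
Proof.
move=> Lf Lw; apply: eq_integrable (L2_mul_integrable _ _ _ _ Lf (Lw i)) => // t _.
by rewrite /= mxE ord1.
Qed.

Lemma int_op_mulmx {d e} (M : 'M[R]_(e, d)) (w : 'I_N -> R -> 'cV[R]_d) phi :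
  (forall k, L2v 0 (tau k) (w k)) -> Htau tau phi ->
  M *m int_op w phi = int_op (fun k t => M *m w k t) phi.
Proof.
move=> Lw hphi; rewrite /int_op mulmx_sumr; apply: eq_bigr => k _.
rewrite mulmx_integralv; last first.
  by move=> i; apply: L2_scale_integrable; [exact: Htau_L2|exact: Lw].
by congr integralv; apply/funext => t; rewrite scalemxAr.
Qed.

Lemma int_op_ae {d} (w w' : 'I_N -> R -> 'cV[R]_d) phi :
  (forall k, L2v 0 (tau k) (w k)) -> (forall k, L2v 0 (tau k) (w' k)) ->
  (forall k, {ae mu, forall t, t \in `[0, tau k] -> w k t = w' k t}) ->
  Htau tau phi -> int_op w phi = int_op w' phi.
Proof.
move=> Lw Lw' ww' hphi; apply: eq_bigr => k _; apply/matrixP => i j; rewrite !mxE.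
apply: ae_eq_Rintegral_itv.
- by apply: L2_scale_integrable; [exact: Htau_L2|exact: Lw].
- suff /integrableP[/measurable_EFinP] :
    mu.-integrable `[0, tau k] (EFin \o (fun t => (phi k t *: w' k t) i 0)) by [].
  by apply: L2_scale_integrable; [exact: Htau_L2|exact: Lw'].
- apply: filterS (ww' k); first exact: (ae_filter_ringOfSetsType mu).
  by move=> t H tk; rewrite H.
Qed.

(** Pairing with v gives the sum of the integrals of phi_k times the scalar function v^T w_k, and
    each summand has its own representer. *)
Lemma int_op_has_adjoint {d} (w : 'I_N -> R -> 'cV[R]_d) :
  (forall k, L2v 0 (tau k) (w k)) -> has_adjoint (int_op w).
Proof.
move=> Lw v; pose g k t := (v^T *m w k t) 0 0.
have Lg k : L2 0 (tau k) (g k) by exact: (L2v_mulmx v^T _ _ _ (Lw k) 0).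
have /choice[psi Hpsi] : forall k, exists psi, H10 0 (tau k) psi /\
    forall phi, H10 0 (tau k) phi ->
    \int[mu]_(t in `[0, tau k]) (phi t * g k t) =
    \int[mu]_(t in `[0, tau k]) (derive1 phi t * derive1 psi t).
  move=> k; have [psi] := H10_representer (tau k) (g k) (tau_gt0 k) (Lg k).
  by exists psi.
exists psi; split=> [k|phi hphi]; first by have [] := Hpsi k.
have -> : (int_op w phi)^T *m v = (v^T *m int_op w phi)^T by rewrite trmx_mul trmxK.
rewrite mxE int_op_mulmx // summxE; apply: eq_bigr => k _.
have [_ <-//] := Hpsi k; rewrite mxE.
by apply: eq_Rintegral => t _; rewrite mxE.
Qed.

End Adjoints.

(** * Definite matrices *)

Section DefiniteMatrices.
Context {R : realType}.

Lemma sqnorm_ge0 {d} (v : 'cV[R]_d) : 0 <= (v^T *m v) 0 0.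
Proof. by rewrite mxE sumr_ge0 // => i _; rewrite mxE -expr2 sqr_ge0. Qed.

Lemma sqnorm_eq0 {d} (v : 'cV[R]_d) : (v^T *m v) 0 0 = 0 -> v = 0.
Proof.
rewrite mxE => /eqP; rewrite psumr_eq0; last first.
  by move=> i _; rewrite mxE -expr2 sqr_ge0.
move=> /allP H; apply/matrixP => i j; rewrite ord1 mxE.
have := H i (mem_index_enum _); rewrite /= mxE -expr2 sqrf_eq0.
by move=> /eqP.
Qed.

(** If v G G^T = 0 then |v G|^2 = 0, and full row rank gives v = 0. *)
Lemma gram_unitmx {d e} (G : 'M[R]_(d, e)) : row_free G -> G *m G^T \in unitmx.
Proof.
move=> fG; rewrite -row_free_unit; apply: inj_row_free => v vG.
have : ((v *m G)^T^T *m (v *m G)^T) 0 0 = 0.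
  by rewrite trmxK trmx_mul -!mulmxA (mulmxA G) (mulmxA v) vG mul0mx mxE.
move=> /sqnorm_eq0 /(congr1 trmx); rewrite trmxK trmx0 => vG0.
by apply: (row_free_inj fG); rewrite vG0 mul0mx.
Qed.

Lemma trmxB {d e} (A B : 'M[R]_(d, e)) : (A - B)^T = A^T - B^T.
Proof. exact: linearB. Qed.

(** Both Gram matrices are invertible by full rank. The two products of F G with the candidate are
    the orthogonal projections onto the column space of F and the row space of G, which yields all
    four equations. *)
Lemma penrose_full_rank_factorization {d r e} (F : 'M[R]_(d, r)) (G : 'M[R]_(r, e)) :
  row_free F^T -> row_free G ->
  penrose (F *m G) (G^T *m invmx (G *m G^T) *m invmx (F^T *m F) *m F^T).
Proof.
move=> fF /gram_unitmx uG; have := gram_unitmx _ fF; rewrite trmxK => uF.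
set g := invmx (G *m G^T); set f := invmx (F^T *m F).
have gT : g^T = g by rewrite trmx_inv trmx_mul trmxK.
have fT : f^T = f by rewrite trmx_inv trmx_mul trmxK.
set P := G^T *m g *m f *m F^T.
have MP : F *m G *m P = F *m f *m F^T.
  rewrite /P !mulmxA -(mulmxA F G) -(mulmxA F (G *m _)) mulmxV // mulmx1 //.
have PM : P *m (F *m G) = G^T *m g *m G.
  by rewrite /P !mulmxA -(mulmxA _ F^T F) -(mulmxA _ f) mulVmx // mulmx1.
split.
- by rewrite MP !mulmxA -(mulmxA _ F^T F) -(mulmxA _ f) mulVmx // mulmx1.
- by rewrite PM /P !mulmxA -(mulmxA _ G G^T) -(mulmxA _ (G *m _)) mulmxV // mulmx1.
- by rewrite MP !trmx_mul trmxK fT mulmxA.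
- by rewrite PM !trmx_mul trmxK gT mulmxA.
Qed.

Lemma penrose_mp_inverse {d e} (M : 'M[R]_(d, e)) : penrose M (mp_inverse M).
Proof.
suff : exists P, penrose M P by move=> H; exact: (xgetPex 0 H).
rewrite -(mulmx_base M); eexists; apply: penrose_full_rank_factorization.
  by rewrite /row_free mxrank_tr; exact: col_base_full.
exact: row_base_free.
Qed.

Lemma psd_tr_mul {d e} (M : 'M[R]_d) (X : 'M[R]_(d, e)) : psd M -> psd (X^T *m M *m X).
Proof.
move=> [MT M0]; split; first by rewrite !trmx_mul trmxK MT mulmxA.
by move=> v; have := M0 (X *m v); rewrite trmx_mul !mulmxA.
Qed.

Lemma psdD {d} (M P : 'M[R]_d) : psd M -> psd P -> psd (M + P).
Proof.
move=> [MT M0] [PT P0]; split; first by rewrite linearD /= MT PT.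
by move=> v; rewrite mulmxDr mulmxDl mxE addr_ge0.
Qed.

(** If w = M v were nonzero, a short move from v in the direction - w would make the quadratic form
    negative. *)
Lemma psd_ker {d} (M : 'M[R]_d) (v : 'cV[R]_d) : psd M ->
  (v^T *m M *m v) 0 0 = 0 -> M *m v = 0.
Proof.
move=> [MT M0] qv; apply: sqnorm_eq0; set w := M *m v.
set a := (w^T *m w) 0 0; set c := (w^T *m M *m w) 0 0.
have a0 : 0 <= a by exact: sqnorm_ge0.
have c0 : 0 <= c by exact: M0.
apply/eqP; rewrite eq_le a0 andbT leNgt; apply/negP => a0'.
(* The added 1 keeps the denominator positive, and s c < a makes - 2 s a + s^2 c negative. *)
pose s := a / (c + 1).
have q : ((v - s *: w)^T *m M *m (v - s *: w)) 0 0 = - 2 * s * a + s ^+ 2 * c.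
  rewrite trmxB linearZ /= !mulmxBl !mulmxBr -!scalemxAl -!scalemxAr.
  have vMw : v^T *m M *m w = w^T *m w by rewrite /w trmx_mul MT mulmxA.
  have wMv : w^T *m M *m v = w^T *m w by rewrite -mulmxA.
  have mB (A B : 'M[R]_1) : (A - B) 0 0 = A 0 0 - B 0 0 by rewrite !mxE.
  have mZ r (A : 'M[R]_1) : (r *: A) 0 0 = r * A 0 0 by rewrite mxE.
  rewrite vMw wMv !mB !mZ -/a -/c qv; ring.
have := M0 (v - s *: w); rewrite q.
have c1 : 0 < c + 1 by rewrite ltr_wpDl.
have s0 : 0 < s by rewrite divr_gt0.
have sc : s * (c + 1) = a by rewrite divfK ?gt_eqF.
nra.
Qed.

Lemma posdef_unitmx {d} (M : 'M[R]_d) : posdef M -> M \in unitmx.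
Proof.
move=> [MT M0]; rewrite -row_free_unit; apply: inj_row_free => v vM.
apply/eqP; apply: contraT => v0.
have := M0 v^T; rewrite trmxK vM mul0mx mxE ltxx; apply.
by apply: contra v0 => /eqP/(congr1 trmx); rewrite trmxK trmx0 => ->.
Qed.

(** The form at v is the form of [Theta] at (v, D v), which is at least its minimum over all second
    components, namely the Schur complement at v. *)
Lemma schur_posdef {n1 n2} (Theta : 'M[R]_(n1 + n2)) (D : 'M[R]_(n2, n1)) :
  psd Theta ->
  posdef (ulsubmx Theta -
    ursubmx Theta *m mp_inverse (drsubmx Theta) *m (ursubmx Theta)^T) ->
  posdef ((col_mx 1%:M D)^T *m Theta *m col_mx 1%:M D).
Proof.
set a := ulsubmx Theta; set b := ursubmx Theta; set c := drsubmx Theta.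
move=> psdT [_ schur]; have [TT T0] := psdT.
have cT : c^T = c by rewrite /c trmx_drsub TT.
have bT : dlsubmx Theta = b^T by rewrite /b trmx_ursub TT.
have TE : Theta = block_mx a b b^T c by rewrite -bT submxK.
have [p1 _ p3 _] := penrose_mp_inverse c; set ci := mp_inverse c in p1 p3 schur.
(* [K] is the orthogonal projection onto the kernel of c. Nonnegativity of [Theta] forces b to
   vanish there, hence b^T = c c^+ b^T, which lets the pseudo-inverse act as an inverse. *)
pose K := 1%:M - c *m ci.
have cK : c *m K = 0.
  apply: trmx_inj; rewrite trmx_mul cT trmxB p3 trmx1 mulmxBl mul1mx p1 subrr.
  by rewrite trmx0.
have bK : b *m K = 0.
  apply/trmx_inj/row_matrixP => i; rewrite trmx0 row0.
  rewrite -tr_col -[RHS]trmx0; congr trmx.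
  rewrite colE -mulmxA; set u := K *m _.
  (* The form of [Theta] at (0, u) is u^T c u = 0, so (0, u) lies in the kernel of [Theta], whose
     upper block reads b u = 0. *)
  have : Theta *m col_mx 0 u = 0.
    apply: psd_ker => //; rewrite TE tr_col_mx trmx0 mul_row_block !mul0mx !add0r.
    rewrite mul_row_col mulmx0 add0r -mulmxA /u (mulmxA c) cK mul0mx mulmx0.
    by rewrite mxE.
  rewrite TE mul_block_col !mulmx0 !add0r => /(congr1 usubmx).
  by rewrite col_mxKu => ->; rewrite linear0.
have bcc : b^T = c *m ci *m b^T.
  have := congr1 trmx bK; rewrite trmx_mul trmx0 trmxB p3 trmx1 mulmxBl mul1mx.
  by move=> /eqP; rewrite subr_eq0 => /eqP.
split; first by rewrite !trmx_mul trmxK TT mulmxA.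
move=> v v0; set y := D *m v.
have -> : v^T *m ((col_mx 1%:M D)^T *m Theta *m col_mx 1%:M D) *m v =
  (col_mx v y)^T *m Theta *m col_mx v y.
  have -> : col_mx v y = col_mx 1%:M D *m v by rewrite mul_col_mx mul1mx.
  by rewrite trmx_mul !mulmxA.
(* Completing the square around the minimizer y0 of y |-> q (v, y). *)
pose y0 := - (ci *m b^T *m v); pose z := y - y0.
have cy0 : c *m y0 = - (b^T *m v).
  by rewrite /y0 mulmxN !mulmxA -bcc.
have y0c : y0^T *m c = - (v^T *m b).
  by rewrite -cT -trmx_mul cy0 linearN /= trmx_mul trmxK.
have -> : (col_mx v y)^T *m Theta *m col_mx v y =
    v^T *m (a - b *m ci *m b^T) *m v + z^T *m c *m z.
  rewrite TE tr_col_mx mul_row_block mul_row_col.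
  rewrite /z trmxB (mulmxBl y^T) y0c opprK (mulmxBr _ y).
  rewrite !mulmxDl -(mulmxA _ c y0) cy0.
  rewrite mulmxBr mulmxBl /y0 !mulmxN !mulmxA.
  rewrite opprD !opprK.
  move: (v^T *m a *m v) (y^T *m b^T *m v) (v^T *m b *m y) (y^T *m c *m y)
    (v^T *m b *m ci *m b^T *m v) => t1 t2 t3 t4 t5.
  by apply/matrixP => i j; rewrite !mxE; ring.
rewrite mxE ltr_pwDl //; first exact: schur.
have := T0 (col_mx 0 z); rewrite TE tr_col_mx trmx0 mul_row_block !mul0mx !add0r.
by rewrite mul_row_col mulmx0 add0r.
Qed.

(** The matrix X below is the projection along the range of C that is orthogonal for the form
    [Theta], and the difference equals X^T Theta X. *)
Lemma psd_schur_projection {d e} (Theta : 'M[R]_d) (C : 'M[R]_(d, e)) :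
  psd Theta -> C^T *m Theta *m C \in unitmx ->
  psd (Theta - Theta *m C *m invmx (C^T *m Theta *m C) *m C^T *m Theta).
Proof.
move=> pT; set M := C^T *m Theta *m C => uM; have [TT _] := pT.
have MT : (invmx M)^T = invmx M by rewrite trmx_inv /M !trmx_mul trmxK TT mulmxA.
pose X := 1%:M - C *m invmx M *m C^T *m Theta.
suff -> : Theta - Theta *m C *m invmx M *m C^T *m Theta = X^T *m Theta *m X.
  exact: psd_tr_mul.
rewrite /X trmxB trmx1 !trmx_mul trmxK TT MT mulmxBl mul1mx.
rewrite !mulmxBr !mulmx1 !mulmxA !mulmxBl.
suff -> : Theta *m C *m invmx M *m C^T *m Theta *m C *m invmx M *m C^T *m Theta =
  Theta *m C *m invmx M *m C^T *m Theta by rewrite subrr subr0.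
set Y := Theta *m C *m invmx M.
suff -> : Y *m C^T *m Theta *m C = Theta *m C by [].
have -> : Y *m C^T *m Theta *m C = Y *m M by rewrite /M !mulmxA.
by rewrite /Y mulmxKV.
Qed.

End DefiniteMatrices.

(** * The data operator *)

Section DataOperator.
Context {R : realType} {n m N : nat} (tau : 'I_N -> R) (tau_gt0 : forall k, 0 < tau k).
Local Notation mu := (@lebesgue_measure R).
Context (x : 'I_N -> R -> 'cV[R]_n) (u : 'I_N -> R -> 'cV[R]_m).
Context (x_H1 : forall k, H1v 0 (tau k) (x k))
  (u_L2 : forall k, L2v 0 (tau k) (u k)).

Definition stack (p q : 'cV[R]_n) (r : 'cV[R]_m) : 'cV[R]_(n + (n + m)) :=
  col_mx p (col_mx (- q) (- r)).

(** Integration by parts moves the derivative from phi to x; phi vanishes at both endpoints, so no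
    boundary term remains. *)
Lemma Xd_opE phi : Htau tau phi ->
  Xd_op tau x phi = int_op tau (fun k t => derivev (x k) t) phi.
Proof.
move=> hphi; rewrite /Xd_op /int_op -sumrN; apply: eq_bigr => k _.
apply/matrixP => i j; rewrite !mxE.
have [hk phi0 phiT] := hphi k.
have := H1_integration_by_parts _ _ _ _ (ltW (tau_gt0 k)) hk (x_H1 k i).
rewrite phi0 phiT !mul0r subr0 => /eqP; rewrite addr_eq0 => /eqP H.
under eq_Rintegral do rewrite mxE.
by rewrite H opprK; apply: eq_Rintegral => t _; rewrite !mxE.
Qed.

Lemma L2v_stack a b (p q : R -> 'cV[R]_n) (r : R -> 'cV[R]_m) :
  L2v a b p -> L2v a b q -> L2v a b r -> L2v a b (fun t => stack (p t) (q t) (r t)).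
Proof.
move=> Lp Lq Lr i; rewrite /stack; case: (split_ordP i) => [j ->|j ->].
  by under eq_fun do rewrite col_mxEu; exact: Lp.
case: (split_ordP j) => [l ->|l ->].
  by under eq_fun do rewrite col_mxEd col_mxEu mxE; apply: L2N; exact: Lq.
by under eq_fun do rewrite col_mxEd col_mxEd mxE; apply: L2N; exact: Lr.
Qed.

Lemma Z_opE phi : Htau tau phi ->
  Z_op tau x u phi = W_op tau (fun k t => derivev (x k) t) x u phi.
Proof.
move=> hphi; rewrite /Z_op Xd_opE // /W_op /int_op /X_op /U_op.
have Lphi k := Htau_L2 tau tau_gt0 phi k hphi.
apply/matrixP => i j; rewrite ord1.
have oppI (T : R) (f : R -> R) (w : R -> R) : L2 0 T f -> L2 0 T w ->
    - (\int[mu]_(t in `[0, T]) (f t * w t)) = \int[mu]_(t in `[0, T]) (f t * - w t).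
  move=> Lf Lw; rewrite -mulN1r -RintegralZl //; last exact: L2_mul_integrable.
  by apply: eq_Rintegral => t _; ring.
case: (split_ordP i) => [l ->|l ->].
  rewrite col_mxEu !summxE; apply: eq_bigr => k _; rewrite !mxE.
  by apply: eq_Rintegral => t _; rewrite [RHS]mxE col_mxEu mxE.
rewrite col_mxEd; case: (split_ordP l) => [l' ->|l' ->].
  rewrite col_mxEu mxE !summxE -sumrN; apply: eq_bigr => k _; rewrite !mxE.
  under eq_Rintegral do rewrite mxE.
  rewrite oppI //; last by apply: H1_L2 (x_H1 k l'); exact: ltW.
  by apply: eq_Rintegral => t _; rewrite [RHS]mxE col_mxEd col_mxEu mxE.
rewrite col_mxEd mxE !summxE -sumrN; apply: eq_bigr => k _; rewrite !mxE.
under eq_Rintegral do rewrite mxE.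
rewrite oppI //; last exact: u_L2.
by apply: eq_Rintegral => t _; rewrite [RHS]mxE !col_mxEd mxE.
Qed.

Lemma L2v_derivev k : L2v 0 (tau k) (derivev (x k)).
Proof. by move=> i; under eq_fun do rewrite mxE; have [_] := x_H1 k i. Qed.

Lemma L2v_H1v k : L2v 0 (tau k) (x k).
Proof. by move=> i; apply: H1_L2 (x_H1 k i); exact: ltW. Qed.

End DataOperator.

(** * Equivalence of data consistency and the matrix inequality *)

Lemma mul_col_stack (R : realType) n m (A : 'M[R]_n) (B : 'M[R]_(n, m)) p q r :
  (col_mx 1%:M (col_mx A^T B^T))^T *m stack p q r = p - A *m q - B *m r.
Proof.
by rewrite /stack !tr_col_mx trmx1 !trmxK !mul_row_col mul1mx !mulmxN addrA.
Qed.

Theorem theorem2p2 (R : realType) (n m N : nat)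
    (n_gt0 : (0 < n)%N) (m_gt0 : (0 < m)%N) (N_gt0 : (0 < N)%N)
    (tau : 'I_N -> R) (tau_gt0 : forall k, 0 < tau k)
    (x : 'I_N -> R -> 'cV[R]_n) (u : 'I_N -> R -> 'cV[R]_m)
    (x_H1 : forall k, H1v 0 (tau k) (x k))
    (u_L2 : forall k, L2v 0 (tau k) (u k))
    (Theta : 'M[R]_(n + (n + m))) (Theta_psd : psd Theta)
    (Theta_schur : posdef (ulsubmx Theta -
       ursubmx Theta *m mp_inverse (drsubmx Theta) *m (ursubmx Theta)^T))
    (A : 'M[R]_n) (B : 'M[R]_(n, m)) :
  let C : 'M[R]_(n + (n + m), n) := col_mx 1%:M (col_mx A^T B^T) in
  Sigma tau x u Theta (A, B) <->
  psd (C^T *m (Theta - gramian tau (Z_op tau x u)) *m C).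
Proof.
move=> C.
pose w1 k t := stack (derivev (x k) t) (x k t) (u k t).
have Lw1 k : L2v 0 (tau k) (w1 k).
  by apply: L2v_stack; [exact: L2v_derivev|exact: L2v_H1v|exact: u_L2].
have aW1 := int_op_has_adjoint tau tau_gt0 w1 Lw1.
have ZE phi : Htau tau phi -> Z_op tau x u phi = int_op tau w1 phi.
  by move=> hphi; rewrite (Z_opE tau tau_gt0 x u x_H1 u_L2).
have aZ : has_adjoint tau (Z_op tau x u).
  move=> v; have [psi [hpsi Hpsi]] := aW1 v; exists psi; split=> // phi hphi.
  by rewrite ZE // Hpsi.
have e1 k t : C^T *m w1 k t = derivev (x k) t - A *m x k t - B *m u k t.
  exact: mul_col_stack.
split.
- move=> [p [q [r [[Lp Lq Lr dW] sys]]]].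
  pose w2 k t := stack (p k t) (q k t) (r k t).
  have Lw2 k : L2v 0 (tau k) (w2 k) by exact: L2v_stack.
  have aW2 := int_op_has_adjoint tau tau_gt0 w2 Lw2.
  have CZW phi : Htau tau phi -> C^T *m Z_op tau x u phi = C^T *m W_op tau p q r phi.
    move=> hphi; rewrite (ZE phi hphi) -[W_op tau p q r phi]/(int_op tau w2 phi).
    rewrite (int_op_mulmx tau tau_gt0 C^T w1 phi Lw1 hphi).
    rewrite (int_op_mulmx tau tau_gt0 C^T w2 phi Lw2 hphi).
    apply: (int_op_ae tau tau_gt0) hphi.
    + by move=> k; exact: L2v_mulmx.
    + by move=> k; exact: L2v_mulmx.
    + move=> k; apply: filterS (sys k).
        exact: (ae_filter_ringOfSetsType lebesgue_measure).
      (* The system equation rearranges to x' - A x - B u = p - A q - B r. *)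
      move=> t H /H /= E; rewrite e1 mul_col_stack.
      move: E => /eqP; rewrite !mulmxBr -subr_eq0 => /eqP E.
      apply/eqP; rewrite -subr_eq0 -[X in _ == X]E; apply/eqP.
      move: (A *m _) (A *m _) (B *m _) (B *m _) => *.
      by apply/matrixP => i j; rewrite !mxE; ring.
  have gE := gramian_congr tau _ _ C^T C^T aZ aW2 CZW.
  rewrite trmxK in gE.
  rewrite mulmxBr mulmxBl gE -mulmxBl -mulmxBr; apply: psd_tr_mul.
  exact: dW.
- move=> H.
  have Mpos : posdef (C^T *m Theta *m C) by exact: schur_posdef.
  set M := C^T *m Theta *m C in Mpos.
  have [MT _] := Mpos; have uM := posdef_unitmx _ Mpos; have [TT _] := Theta_psd.
  (* A right inverse of C^T that also satisfies K M K^T <= Theta. *)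
  pose K := Theta *m C *m invmx M.
  have CK : C^T *m K = 1%:M by rewrite /K !mulmxA -/M mulmxV.
  pose w2 k t := K *m (C^T *m w1 k t).
  pose p k t := usubmx (w2 k t).
  pose q k t := - usubmx (dsubmx (w2 k t)).
  pose r k t := - dsubmx (dsubmx (w2 k t)).
  have w2E k t : stack (p k t) (q k t) (r k t) = w2 k t.
    by rewrite /stack /q /r !opprK !vsubmxK.
  have Lw2 k : L2v 0 (tau k) (w2 k) by do 2!apply: L2v_mulmx; exact: Lw1.
  have aW2 := int_op_has_adjoint tau tau_gt0 w2 Lw2.
  have WE : W_op tau p q r = int_op tau w2.
    by rewrite -[W_op _ _ _ _]/(int_op tau (fun k t => stack (p k t) (q k t) (r k t)));
      congr int_op; apply/funext => k; apply/funext => t.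
  exists p, q, r; split.
  + split.
    * by move=> k i; under eq_fun do rewrite mxE; exact: Lw2.
    * by move=> k i; under eq_fun do rewrite 3!mxE; apply: L2N; exact: Lw2.
    * by move=> k i; under eq_fun do rewrite 3!mxE; apply: L2N; exact: Lw2.
    rewrite /loewner_le WE.
    have WZ phi : Htau tau phi ->
        1%:M *m int_op tau w2 phi = (K *m C^T) *m Z_op tau x u phi.
      move=> hphi; rewrite mul1mx ZE // int_op_mulmx //; congr (int_op tau _ phi).
      by apply/funext => k; apply/funext => t; rewrite /w2 mulmxA.
    have := gramian_congr tau _ _ 1%:M (K *m C^T) aW2 aZ WZ.
    rewrite trmx1 mul1mx mulmx1 => ->.
    have KT : K^T = invmx M *m C^T *m Theta by rewrite /K !trmx_mul trmx_inv MT TT mulmxA.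
    (* The term K C^T Theta C K^T = Theta C M^-1 C^T Theta is subtracted and added; this splits
       Theta - W W^* into a Schur-type remainder and a congruence of the matrix in [H]. *)
    have -> : Theta - K *m C^T *m gramian tau (Z_op tau x u) *m (K *m C^T)^T =
      (Theta - Theta *m C *m invmx M *m C^T *m Theta) +
      (K^T)^T *m (C^T *m (Theta - gramian tau (Z_op tau x u)) *m C) *m K^T.
      rewrite trmx_mul !trmxK mulmxBr mulmxBl mulmxBr mulmxBl !mulmxA.
      have -> : K *m C^T *m Theta *m C *m K^T = Theta *m C *m invmx M *m C^T *m Theta.
        have -> : K *m C^T *m Theta *m C = K *m M by rewrite /M !mulmxA.
        by rewrite KT /K mulmxKV // !mulmxA.
      by rewrite addrA subrK.
    apply: psdD; first exact: psd_schur_projection.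
    exact: psd_tr_mul.
  (* Since C^T K = 1, the noise reproduces the residual at every t, not only almost everywhere. *)
  + move=> k; apply: aeW => t _ /=.
    have := mul_col_stack _ _ _ A B (p k t) (q k t) (r k t).
    rewrite w2E /w2 mulmxA -/C CK mul1mx e1 => /eqP; rewrite -subr_eq0 => /eqP E.
    apply/eqP; rewrite -subr_eq0 -[X in _ == X]E !mulmxBr; apply/eqP.
    move: (A *m _) (A *m _) (B *m _) (B *m _) => *.
    by apply/matrixP => i j; rewrite !mxE; ring.
Qed.
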